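(* Let $U\subseteq R^m(-\mathbf d)$ be a quasi-stable module. The functors $\underline{\mathbf{Mf}}^{\mathrm{syz}}_U$ and $\underline{\mathbf{Mf}}^{\mathrm{res}}_U$ are representable, and the schemes $\mathbf{Mf}^{\mathrm{syz}}_U$ and $\mathbf{Mf}^{\mathrm{res}}_U$ representing them are isomorphic to the scheme $\mathbf{Mf}_U$ representing the $U$-marked functor $\underline{\mathbf{Mf}}_U$.
   Context: $\mathbb K$ is a field, $R=\mathbb K[x_0,\dots,x_n]$ with the standard grading and $x_0<\dots<x_n$; for a Noetherian $\mathbb K$-algebra $A$, $R_A=R\otimes_{\mathbb K}A$. A term of $R$ is a monomial $x^\alpha$; for $x^\alpha\neq1$, $\min(x^\alpha)$ is the smallest variable dividing it. Variables $x_i>\min(x^\alpha)$ are non-multiplicative for $x^\alpha$ (the term $1$ has no non-multiplicative variables). $R_A^m(-\mathbf d)=\bigoplus_k R_A(-d_k)\mathbf e_k$, with terms $x^\alpha\mathbf e_k$ of degree $|\alpha|+d_k$. All submodules are graded. A submodule is monomial if generated by terms; $\mathcal N(U)$ is the set of terms not in $U$. Pommaret cone: $\mathcal C(x^\alpha)=\{x^\delta x^\alpha\mid\delta_i=0\ \forall x_i>\min(x^\alpha)\}$ for $x^\alpha\neq 1$, $\mathcal C(1)=$ all terms, $\mathcal C(x^\alpha\mathbf e_k)=\mathcal C(x^\alpha)\mathbf e_k$. A Pommaret basis of $U$ is a set of terms generating $U$ whose cones partition the set of terms of $U$; it is unique if it exists, denoted $\mathcal P_U$. $U$ is quasi-stable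 if it has a finite Pommaret basis, stable if moreover $\mathcal P_U$ is its minimal monomial generating set. Put $D=\min\{i\mid x_i=\min(x^\alpha),\ x^\alpha\mathbf e_k\in\mathcal P_U\}$. A $U$-marked set in $R_A^m(-\mathbf d)$ is a finite set $F=\{f_{\alpha,k}\}_{x^\alpha\mathbf e_k\in\mathcal P_U}$ of homogeneous elements such that $x^\alpha\mathbf e_k$ has coefficient $1$ in $f_{\alpha,k}$ and the support of $f_{\alpha,k}-x^\alpha\mathbf e_k$ is in $\mathcal N(U)$; it is a $U$-marked basis of $(F)$ if $R_A^m(-\mathbf d)=(F)\oplus\langle\mathcal N(U)\rangle_A$ (equivalently in each degree). A graded submodule $M$ satisfies $M\oplus\langle\mathcal N(U)\rangle=R_A^m(-\mathbf d)$ iff it is generated by a (necessarily unique) $U$-marked basis $F$. Then each $f\in(F)$ has a unique writing $f=\sum P_{\gamma,\ell}f_{\gamma,\ell}$ with all terms of $P_{\gamma,\ell}x^\gamma$ in $\mathcal C(x^\gamma)$. Fundamental syzygies: for $x_i>\min(x^\alpha)$, $S_{i,\alpha,k}=x_i\mathbf f_{\alpha,k}-\sum P_{\gamma,\ell}\mathbf f_{\gamma,\ell}$, where $x_if_{\alpha,k}=\sum P_{\gamma,\ell}f_{\gamma,\ell}$ is the unique writing and $\mathbf f_{\alpha,k}$ is the standard basis of $\bigoplus R_A(-\deg x^\alpha\mathbf e_k)\mathbf f_{\alpha,k}$. They form a set $F^{\partial_1}$ which is a marked basis (head terms $x_i\mathbf f_{\alpha,k}$) of the syzygy module of $F$ over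 the stable module $U^{(1)}$ with Pommaret basis $\{x_i\mathbf f_{\alpha,k}\mid x_i>\min(x^\alpha)\}$. Iterating, $F^{\partial_0}=F$ and $F^{\partial_t}$ is the set of fundamental syzygies of $F^{\partial_{t-1}}$. Functors from Noetherian $\mathbb K$-algebras to sets: $\underline{\mathbf{Mf}}_U(A)=\{M\subset R_A^m(-\mathbf d)\mid M\oplus\langle\mathcal N(U)\rangle=R_A^m(-\mathbf d)\}$; $\underline{\mathbf{Mf}}^{\mathrm{syz}}_U(A)=\{(M,S_1)\mid M\in\underline{\mathbf{Mf}}_U(A),\ S_1\text{ is the syzygy module of }F^{\partial_0}\}$; $\underline{\mathbf{Mf}}^{\mathrm{res}}_U(A)=\{(M,S_1,\dots,S_{n-D})\mid M\in\underline{\mathbf{Mf}}_U(A),\ S_t\text{ is the syzygy module of }F^{\partial_{t-1}}\ \forall t>0\}$, where $F$ is the $U$-marked basis of $M$. On morphisms $\sigma:A\to A'$ they act by extension of scalars (applying $\sigma$ to the coefficients of the marked bases). It is known that $\underline{\mathbf{Mf}}_U$ is represented by an affine scheme $\mathbf{Mf}_U$ of finite type over $\mathbb K$. *)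

(* Defs.v *)
From HB Require Import structures.
From mathcomp Require Import all_boot all_order all_algebra.
From mathcomp.multinomials Require Import mpoly.

Set Implicit Arguments.
Unset Strict Implicit.
Unset Printing Implicit Defensive.

Import GRing.Theory.
Local Open Scope ring_scope.

(* Conventions: R_A = {mpoly A[n.+1]} with x_0 < ... < x_n indexed by           *)
(* 'I_n.+1, and R_A^m = 'rV[{mpoly A[n.+1]}]_m; the twists d_k enter only        *)
(* through [homogeneous]. Subsets of R_A^m are predicates into Prop.             *)

Section Terms.

Variable n : nat.

(* (a, k) stands for the term x^a e_k. *)
Definition term (m : nat) : Type := ('X_{1..n.+1} * 'I_m)%type.

(* Index of the smallest variable dividing x^a. The default ord_max for a = 0    *)
(* makes every variable multiplicative for the term 1.                           *)
Definition mvar (a : 'X_{1..n.+1}) : 'I_n.+1 :=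
  odflt ord_max [pick i | (a i != 0%N) && [forall j, (a j != 0%N) ==> (i <= j)%N]].

(* The term b lies in the Pommaret cone of the term p. *)
Definition in_cone (m : nat) (p b : term m) : bool :=
  [&& p.2 == b.2, (p.1 <= b.1)%MM
    & [forall i : 'I_n.+1, (mvar p.1 < i)%N ==> ((b.1 - p.1)%MM i == 0%N)]].

Definition tvec (A : comNzRingType) (m : nat) (b : term m) :
    'rV[{mpoly A[n.+1]}]_m :=
  'X_[b.1] *: delta_mx 0 b.2.

Definition coef (A : comNzRingType) (m : nat)
    (u : 'rV[{mpoly A[n.+1]}]_m) (b : term m) : A :=
  (u 0 b.2)@_(b.1).

Definition homogeneous (A : comNzRingType) (m : nat) (d : 'I_m -> int)
    (e : int) (u : 'rV[{mpoly A[n.+1]}]_m) : Prop :=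
  forall b : term m, coef u b != 0 -> Posz (mdeg b.1) + d b.2 = e.

Definition submodule (A : comNzRingType) (m : nat)
    (M : 'rV[{mpoly A[n.+1]}]_m -> Prop) : Prop :=
  M 0 /\ forall (r : {mpoly A[n.+1]}) u v, M u -> M v -> M (r *: u + v).

Definition graded (A : comNzRingType) (m : nat) (d : 'I_m -> int)
    (M : 'rV[{mpoly A[n.+1]}]_m -> Prop) : Prop :=
  forall u, M u -> exists2 s : seq 'rV[{mpoly A[n.+1]}]_m,
    (forall v, v \in s -> M v /\ exists e, homogeneous d e v)
    & u = \sum_(v <- s) v.

Definition generated_by_rows (A : comNzRingType) (k m : nat)
    (F : 'M[{mpoly A[n.+1]}]_(k, m)) (M : 'rV[{mpoly A[n.+1]}]_m -> Prop) : Prop :=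
  forall u, M u <-> exists w : 'rV[{mpoly A[n.+1]}]_k, u = w *m F.

Definition syzygies (A : comNzRingType) (k m : nat)
    (F : 'M[{mpoly A[n.+1]}]_(k, m)) (w : 'rV[{mpoly A[n.+1]}]_k) : Prop :=
  w *m F = 0.

(* P enumerates the Pommaret basis of U; the existence of such a (finite) P is   *)
(* the quasi-stability of U, and forces U to be a monomial submodule.            *)
Definition pommaret_basis (K : fieldType) (m : nat)
    (U : 'rV[{mpoly K[n.+1]}]_m -> Prop) (P : seq (term m)) : Prop :=
  [/\ uniq P,
      generated_by_rows
        (\matrix_(j < size P) tvec K (tnth (in_tuple P) j)) U,
      forall p b, p \in P -> in_cone p b -> U (tvec K b)
    & forall b, U (tvec K b) -> exists! p, p \in P /\ in_cone p b].

Definition normal_term (K : fieldType) (m : nat)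
    (U : 'rV[{mpoly K[n.+1]}]_m -> Prop) (b : term m) : Prop :=
  ~ U (tvec K b).

(* The A-module <N(U)>_A spanned by the terms not in U. *)
Definition normal_span (K : fieldType) (m : nat)
    (U : 'rV[{mpoly K[n.+1]}]_m -> Prop) (A : comNzRingType)
    (h : 'rV[{mpoly A[n.+1]}]_m) : Prop :=
  forall b, coef h b != 0 -> normal_term U b.

(* M (+) <N(U)>_A = R_A^m. *)
Definition complements_normal (K : fieldType) (m : nat)
    (U : 'rV[{mpoly K[n.+1]}]_m -> Prop) (A : comNzRingType)
    (M : 'rV[{mpoly A[n.+1]}]_m -> Prop) : Prop :=
  (forall u, exists v h, [/\ M v, normal_span U h & u = v + h]) /\
  (forall u, M u -> normal_span U u -> u = 0).

(* Row j of F is the marked element whose head term is the j-th entry of P. *)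
Definition marked_set (K : fieldType) (m : nat) (d : 'I_m -> int)
    (U : 'rV[{mpoly K[n.+1]}]_m -> Prop) (P : seq (term m)) (A : comNzRingType)
    (F : 'M[{mpoly A[n.+1]}]_(size P, m)) : Prop :=
  forall j, let p := tnth (in_tuple P) j in
    [/\ exists e, homogeneous d e (row j F),
        coef (row j F) p = 1
      & normal_span U (row j F - tvec A p)].

(* F is a U-marked basis, and M = (F). *)
Definition marked_basis (K : fieldType) (m : nat) (d : 'I_m -> int)
    (U : 'rV[{mpoly K[n.+1]}]_m -> Prop) (P : seq (term m)) (A : comNzRingType)
    (F : 'M[{mpoly A[n.+1]}]_(size P, m))
    (M : 'rV[{mpoly A[n.+1]}]_m -> Prop) : Prop :=
  [/\ marked_set d U F, generated_by_rows F M & complements_normal U M].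

(* A stage of the iteration: the rank of the ambient free module and the         *)
(* Pommaret basis of the head terms. At stage t the ambient module is free on    *)
(* the elements of F^(d_(t-1)) and the head terms are those of F^(d_t).          *)
Record stage : Type := Stage { rank : nat; heads : seq (term rank) }.

Definition head_term (s : stage) (j : 'I_(size (heads s))) : term (rank s) :=
  tnth (in_tuple (heads s)) j.

(* The head terms x_i f_j, for x_i non-multiplicative for the j-th head term. *)
Definition next_stage (s : stage) : stage :=
  @Stage (size (heads s))
    [seq (U_(i)%MM, j) | j <- enum 'I_(size (heads s)),
                         i <- [seq i : 'I_n.+1 <- enum 'I_n.+1 | (mvar (head_term j).1 < i)%N]].

Fixpoint stages (m : nat) (P : seq (term m)) (t : nat) : stage :=
  if t is t'.+1 then next_stage (stages P t') else @Stage m P.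

(* All terms of w_l x^c lie in the cone of x^c, for x^c e_k the l-th head term. *)
Definition cone_coefficients (A : comNzRingType) (s : stage)
    (w : 'rV[{mpoly A[n.+1]}]_(size (heads s))) : Prop :=
  forall l (b : 'X_{1..n.+1}), (w 0 l)@_b != 0 ->
    in_cone (head_term l) ((b + (head_term l).1)%MM, (head_term l).2).

(* The rows of G are the fundamental syzygies of the rows of F. *)
Definition fundamental_syzygies (A : comNzRingType) (s : stage)
    (F : 'M[{mpoly A[n.+1]}]_(size (heads s), rank s))
    (G : 'M[{mpoly A[n.+1]}]_(size (heads (next_stage s)), rank (next_stage s))) : Prop :=
  forall j : 'I_(size (heads (next_stage s))), let h := head_term j in
    exists w : 'rV[{mpoly A[n.+1]}]_(size (heads s)),
      [/\ cone_coefficients w, 'X_[h.1] *: row h.2 F = w *m F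
        & row j G = tvec A h - w].

(* The number D; the initial value n only matters when P has no term other than  *)
(* the e_k, in which case there are no fundamental syzygies and n - D = 0.       *)
Definition pommaret_D (m : nat) (P : seq (term m)) : nat :=
  \big[minn/n]_(p <- P) (mvar p.1 : nat).

(* The submodule of R_A'^m generated by the image of M. *)
Definition extend_scalars (A A' : comNzRingType) (sigma : A -> A') (m : nat)
    (M : 'rV[{mpoly A[n.+1]}]_m -> Prop) (u : 'rV[{mpoly A'[n.+1]}]_m) : Prop :=
  exists k (V : 'M[{mpoly A[n.+1]}]_(k, m)) (c : 'rV[{mpoly A'[n.+1]}]_k),
    (forall i, M (row i V)) /\ u = c *m map_mx (map_mpoly sigma) V.

End Terms.

Definition ideal (A : comNzRingType) (I : A -> Prop) : Prop :=
  I 0 /\ forall r x y, I x -> I y -> I (r * x + y).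

Definition noetherian (A : comNzRingType) : Prop :=
  forall I : A -> Prop, ideal I ->
    exists k (g : 'I_k -> A),
      forall x, I x <-> exists c : 'I_k -> A, x = \sum_(i < k) c i * g i.

Definition finite_type (K : fieldType) (B : comAlgType K) : Prop :=
  exists k (f : {lrmorphism {mpoly K[k]} -> B}), forall b, exists p, f p = b.

Definition isomorphic_algebras (K : fieldType) (B B' : comAlgType K) : Prop :=
  exists f : {lrmorphism B -> B'}, bijective f.

(* A functor from K-algebras to sets whose value at A is a subset [fmem] of      *)
(* [fcar A] and which acts on morphisms by the restriction of [fmap]. That       *)
(* [fmap] preserves [fmem] is not a field: it is part of [represents].           *)
Record set_functor (K : fieldType) : Type := SetFunctor {
  fcar : comAlgType K -> Type;
  fmem : forall A : comAlgType K, fcar A -> Prop;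
  fmap : forall A A' : comAlgType K, {lrmorphism A -> A'} -> fcar A -> fcar A'
}.

(* Spec B represents F: there is a bijection Hom_K(B, A) ~ F(A), natural in the  *)
(* Noetherian K-algebra A.                                                       *)
Definition represents (K : fieldType) (B : comAlgType K) (F : set_functor K) :
    Prop :=
  noetherian B /\
  exists Phi : forall A : comAlgType K, {lrmorphism B -> A} -> fcar F A,
    [/\ forall (A : comAlgType K) (phi : {lrmorphism B -> A}),
          noetherian A -> fmem (Phi A phi),
        forall (A : comAlgType K) (x : fcar F A),
          noetherian A -> fmem x ->
          exists phi : {lrmorphism B -> A}, Phi A phi = x,
        forall (A : comAlgType K) (phi psi : {lrmorphism B -> A}),
          noetherian A -> Phi A phi = Phi A psi -> phi =1 psi
      & forall (A A' : comAlgType K) (sigma : {lrmorphism A -> A'})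
          (phi : {lrmorphism B -> A}), noetherian A -> noetherian A' ->
          Phi A' (sigma \o phi : {lrmorphism B -> A'}) = fmap sigma (Phi A phi)].

Section Functors.

Variables (K : fieldType) (n m : nat) (d : 'I_m -> int).
Variables (U : 'rV[{mpoly K[n.+1]}]_m -> Prop) (P : seq (term n m)).

Definition mf_mem (A : comAlgType K) (M : 'rV[{mpoly A[n.+1]}]_m -> Prop) : Prop :=
  [/\ submodule M, graded d M & complements_normal U M].

Definition Mf : set_functor K :=
  {| fcar := fun A => 'rV[{mpoly A[n.+1]}]_m -> Prop;
     fmem := mf_mem;
     fmap := fun A A' sigma M => extend_scalars sigma M |}.

Definition syz_mem (A : comAlgType K)
    (x : ('rV[{mpoly A[n.+1]}]_m -> Prop) *
         ('rV[{mpoly A[n.+1]}]_(size P) -> Prop)) : Prop :=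
  mf_mem x.1 /\
  exists2 F : 'M[{mpoly A[n.+1]}]_(size P, m),
    marked_basis d U F x.1 & forall w, x.2 w <-> syzygies F w.

Definition Mf_syz : set_functor K :=
  {| fcar := fun A => (('rV[{mpoly A[n.+1]}]_m -> Prop) *
                       ('rV[{mpoly A[n.+1]}]_(size P) -> Prop))%type;
     fmem := syz_mem;
     fmap := fun A A' sigma x =>
       (extend_scalars sigma x.1, extend_scalars sigma x.2) |}.

(* The component of index t : 'I_(n - D) is S_(t+1), the syzygy module of        *)
(* F^(d_t); it lives in the free module on the elements of F^(d_t).              *)
Definition res_car (A : comAlgType K) : Type :=
  (('rV[{mpoly A[n.+1]}]_m -> Prop) *
   (forall t : 'I_(n - pommaret_D P),
      'rV[{mpoly A[n.+1]}]_(size (heads (stages P t))) -> Prop))%type.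

Definition res_mem (A : comAlgType K) (x : res_car A) : Prop :=
  mf_mem x.1 /\
  exists F : forall t : nat,
      'M[{mpoly A[n.+1]}]_(size (heads (stages P t)), rank (stages P t)),
    [/\ marked_basis d U (F 0%N) x.1,
        forall t, fundamental_syzygies (F t) (F t.+1)
      & forall t w, x.2 t w <-> syzygies (F t) w].

Definition Mf_res : set_functor K :=
  {| fcar := res_car;
     fmem := res_mem;
     fmap := fun A A' sigma x =>
       (extend_scalars sigma x.1, fun t => extend_scalars sigma (x.2 t)) |}.

End Functors.

(* Main.v *)
Require Import Defs.
From HB Require Import structures.
From mathcomp Require Import all_boot all_order all_algebra.
From mathcomp.multinomials Require Import ssrcomplements mpoly.
From Stdlib Require Import ClassicalEpsilon FunctionalExtensionality.
From Stdlib Require Import PropExtensionality ProofIrrelevance.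

Set Implicit Arguments.
Unset Strict Implicit.
Unset Printing Implicit Defensive.

Import Order.TTheory GRing.Theory.
Local Open Scope ring_scope.

(** Fix a Pommaret basis [P] of [U]. A matrix [F] with one row for each head term
    [p] of [P], equal to [p] plus normal terms, divides every element of the free
    module: [u = w *m F + h] with [h] normal and every term of [w_p * p] in the cone
    of [p]. Division terminates because rewriting [x^a p] by [x^a f_p] only brings in
    normal terms and terms whose cofactors are lexicographically smaller than [a]
    ([cone_cofactor_lt], [marked_span]), and the same order gives uniqueness of the
    writing ([marked_independent]). Hence [F] is a marked basis exactly when every
    combination of its rows already has a writing with coefficients in the cones
    ([cone_closed]), a condition that is stable under extension of scalars.

    Representability of the marked functor. A graded [M] complementary to the normal
    terms has a unique marked basis ([mf_mem_marked_basis],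
    [marked_basis_unique]), and by homogeneity a marked set has finitely many
    coefficients, which can be prescribed freely. Over the polynomial ring [C] in
    these coefficients there is a universal marked set, and the coefficients of the
    remainders of its combinations generate an ideal that a morphism [C -> A] kills
    if and only if the induced marked set is a marked basis
    ([obstruction_ideal_kernel]). So the quotient of [C] by this ideal represents
    the functor ([Mf_representable]); it is Noetherian by the basis theorem
    ([mpoly_noetherian]).

    Syzygies. If [F] is a marked basis, the rows of a matrix [G] of fundamental
    syzygies are marked on the terms [x_i f_p] with [x_i] non-multiplicative for [p],
    and these terms are again the Pommaret basis of what they generate
    ([cone_partition_next]). A combination of the [f_p] is reduced for [G] exactly
    when its coefficients lie in the cones of [F] ([normal_nextE]), so a reduced
    syzygy is zero: [G] generates the syzygies of [F] and is a marked basis of them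
    ([syzygy_cone_writing]). The construction can therefore be repeated, each step is
    uniquely determined by the previous one, and, the syzygy modules being generated
    by matrices that commute with scalar extension, so do the modules themselves
    ([extend_scalars_syzygies]).

    Consequently forgetting the syzygy modules is a natural bijection from the syzygy
    and resolution functors to the marked functor. The three functors have the same
    representing algebras ([represents_lift], [represents_of_lift]), and these are
    unique up to isomorphism ([represents_unique]). *)

(** * The basis theorem for polynomials over a field *)

(** Induction on the number of variables: a finite basis of the projection of [S]
    that forgets the first exponent lifts to elements of [S] whose first exponents
    are at most some [T]. The lifts settle the elements with first exponent above
    [T], and each of the finitely many lower slices has a basis of its own. *)
Lemma dickson_seq (k : nat) (S : seq nat -> Prop) :
  (forall a, S a -> size a = k) ->
  exists s : seq (seq nat), (forall a, a \in s -> S a) /\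
    forall a, S a -> exists2 b, b \in s & all2 leq b a.
Proof.
elim: k S => [|k IH] S Ssize.
  have [S0|nS0] := classic (S [::]).
    exists [:: [::]]; split=> [a|a Sa]; first by rewrite inE => /eqP ->.
    by exists [::]; rewrite ?inE ?(size0nil (Ssize a Sa)).
  by exists [::]; split=> // a Sa; move: (Sa); rewrite (size0nil (Ssize a Sa)).
have slice (t : nat) : exists s : seq (seq nat),
    (forall a, a \in s -> S (t :: a)) /\
    forall a, S (t :: a) -> exists2 b, b \in s & all2 leq b a.
  by apply: (IH (fun a => S (t :: a))) => a /Ssize [].
have [s [sS' s_basis]] : exists s : seq (seq nat),
    (forall a, a \in s -> exists t, S (t :: a)) /\
    forall a, (exists t, S (t :: a)) -> exists2 b, b \in s & all2 leq b a.
  by apply: (IH (fun a => exists t, S (t :: a))) => a [t /Ssize []].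
have [T TP] : exists T, forall a, a \in s -> exists2 t, S (t :: a) & (t <= T)%N.
  elim: s {s_basis} sS' => [|a s IHs] sS'; first by exists 0%N.
  have [T TP] := IHs (fun b bs => sS' b (mem_behead (s := a :: s) bs)).
  have [t tP] := sS' a (mem_head a s).
  exists (maxn t T) => b; rewrite inE => /predU1P[->|/TP[t' ? le_t'T]].
    by exists t; rewrite ?leq_maxl.
  by exists t' => //; rewrite leq_max le_t'T orbT.
have [sT [sTS sT_basis]] : exists sT : seq (seq nat), (forall a, a \in sT -> S a) /\
    forall t a, (t <= T)%N -> S (t :: a) ->
      exists2 b, b \in sT & all2 leq b (t :: a).
  elim: T {TP} => [|T [sT [sTS sT_basis]]].
    have [s0 [s0S s0P]] := slice 0%N.
    exists [seq 0%N :: a | a <- s0]; split=> [_ /mapP[a /s0S ? ->] //|t a].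
    rewrite leqn0 => /eqP -> /s0P[b bs le_ba].
    by exists (0%N :: b); rewrite ?map_f.
  have [s0 [s0S s0P]] := slice T.+1.
  exists ([seq T.+1 :: a | a <- s0] ++ sT); split=> [a|t a].
    by rewrite mem_cat => /orP[/mapP[b /s0S ? ->] //|/sTS].
  rewrite leq_eqVlt => /predU1P[-> /s0P[b bs le_ba]|].
    by exists (T.+1 :: b); rewrite ?mem_cat ?map_f //= leqnn.
  move=> /sT_basis H /H[b bs le_ba].
  by exists b; rewrite ?mem_cat ?bs ?orbT.
exists sT; split=> // -[/Ssize //|t a Sta].
have [/sT_basis H|lt_Tt] := leqP t T; first exact: H.
have [b bs le_ba] := s_basis a (ex_intro _ t Sta).
have [t' St' le_t'T] := TP b bs.
have [[|t'' c] cs //= /andP[le_t'' le_c]] := sT_basis t' b le_t'T St'.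
exists (t'' :: c) => //=; apply/andP; split.
  exact: leq_trans le_t'' (leq_trans le_t'T (ltnW lt_Tt)).
have leq_all2_trans : forall x y z : seq nat,
    all2 leq x y -> all2 leq y z -> all2 leq x z.
  elim=> [|x1 x IHx] [|y1 y] [|z1 z] //= /andP[le1 le2] /andP[le3 le4].
  by rewrite (leq_trans le1 le3) (IHx y z).
exact: leq_all2_trans le_c le_ba.
Qed.

Lemma dickson (k : nat) (S : 'X_{1..k} -> Prop) :
  exists s : seq 'X_{1..k}, (forall a, a \in s -> S a) /\
    forall a, S a -> exists2 b, b \in s & (b <= a)%MM.
Proof.
pose S' (x : seq nat) := exists2 a : 'X_{1..k}, S a & x = a.
have [s [sS s_basis]] : exists s : seq (seq nat), (forall a, a \in s -> S' a) /\
    forall a, S' a -> exists2 b, b \in s & all2 leq b a.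
  by apply: (@dickson_seq k S') => _ [a _ ->]; rewrite size_tuple.
have {sS} [s' s'S ss'] : exists2 s' : seq 'X_{1..k}, (forall a, a \in s' -> S a)
    & forall x, x \in s -> exists2 a : 'X_{1..k}, a \in s' & x = a.
  elim: s sS {s_basis} => [|x s IHs] sS; first by exists [::].
  have [s' s'S ss'] := IHs (fun b bs => sS b (mem_behead (s := x :: s) bs)).
  have [a Sa xa] := sS x (mem_head x s).
  exists (a :: s') => [b|y]; rewrite inE => /predU1P[->|] //; first exact: s'S.
    by exists a; rewrite ?mem_head.
  by move=> /ss'[b bs' yb]; exists b; rewrite // inE bs' orbT.
exists s'; split=> // a Sa.
have [_ /ss'[b bs' ->] le_ba] := s_basis (val (val a)) (ex_intro2 _ _ a Sa erefl).
exists b => //; apply/mnm_lepP => i; rewrite !(mnm_nth 0%N).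
have all2_nth : forall (x y : seq nat) l, all2 leq x y ->
    (nth 0 x l <= nth 0 y l)%N.
  by elim=> [|x1 x IHx] [|y1 y] [|l] //= /andP[] // _ /IHx.
exact: all2_nth.
Qed.

Lemma mlead_sub_lt (K : fieldType) (k : nat) (f g : {mpoly K[k]}) :
  f - g != 0 -> mlead f = mlead g -> mleadc f = mleadc g ->
  (mlead (f - g) < mlead f)%O.
Proof.
move=> fg_neq0 eq_m eq_c; rewrite lt_neqAle; apply/andP; split.
  apply: contraNneq fg_neq0 => eq_fg.
  by rewrite -mleadc_eq0 eq_fg mcoeffB eq_c -eq_m subrr.
by apply: le_trans (mleadB_le f g) _; rewrite -eq_m joinxx.
Qed.

(** Finitely many elements of an ideal have leading monomials dividing all
    leading monomials of the ideal; they generate it because division by them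
    strictly decreases the leading monomial. *)
Lemma mpoly_noetherian (K : fieldType) (k : nat) : noetherian {mpoly K[k]}.
Proof.
move=> I [I0 Iaxpy].
have [s [sI s_basis]] :=
  @dickson k (fun a => exists2 f : {mpoly K[k]}, I f /\ f != 0 & mlead f = a).
have [G GI Gs] : exists2 G : seq {mpoly K[k]}, (forall g, g \in G -> I g /\ g != 0)
    & forall a, a \in s -> exists2 g, g \in G & mlead g = a.
  elim: s sI {s_basis} => [|a s IHs] sI; first by exists [::].
  have [G GI Gs] := IHs (fun b bs => sI b (mem_behead (s := a :: s) bs)).
  have [g [Ig nz_g] ga] := sI a (mem_head a s).
  exists (g :: G) => [f|b]; rewrite inE => /predU1P[->|] //; first exact: GI.
    by exists g; rewrite ?mem_head.
  by move=> /Gs[f fG fb]; exists f; rewrite // inE fG orbT.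
exists (size G), (fun i => tnth (in_tuple G) i) => f; split; last first.
  move=> [c ->]; apply: (big_ind I) => // [x y Ix Iy|i _].
    by rewrite -[x]mul1r; apply: Iaxpy.
  rewrite -[X in I X]addr0; apply: Iaxpy => //.
  by case: (GI _ (mem_tnth i (in_tuple G))).
elim/mleadrect: f => f IH If; have [->|nz_f] := eqVneq f 0.
  by exists (fun=> 0); rewrite big1 // => i _; rewrite mul0r.
have [_ /Gs[g gG <-] le_gf] := s_basis (mlead f)
  (ex_intro2 _ _ f (conj If nz_f) erefl).
have [Ig nz_g] := GI g gG.
pose q := (mleadc f / mleadc g) *: 'X_[mlead f - mlead g].
have lc_neq0 : mleadc f / mleadc g != 0.
  by rewrite mulf_neq0 ?invr_eq0 ?mleadc_eq0.
have nz_q : q != 0.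
  by rewrite -mleadc_eq0 mleadZ // mleadXm mcoeffZ mcoeffX eqxx mulr1.
have lead_qg : mlead (q * g) = mlead f.
  by rewrite mleadM // mleadZ // mleadXm submK.
have leadc_qg : mleadc (q * g) = mleadc f.
  rewrite mleadM // mleadcM mleadZ // mleadXm mcoeffZ mcoeffX eqxx mulr1.
  by rewrite divfK // mleadc_eq0.
have [c cP] : exists c : 'I_(size G) -> {mpoly K[k]},
    f - q * g = \sum_i c i * tnth (in_tuple G) i.
  have [->|nz_fqg] := eqVneq (f - q * g) 0.
    by exists (fun=> 0); rewrite big1 // => i _; rewrite mul0r.
  apply: IH; first exact: mlead_sub_lt.
  by rewrite addrC -mulNr; apply: Iaxpy.
have /tnthP[i0 gi0] : g \in in_tuple G by [].
exists (fun i => c i + (if i == i0 then q else 0)).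
under eq_bigr do rewrite mulrDl; rewrite big_split /= -cP.
rewrite [X in _ + X](bigD1 i0) //= eqxx -gi0 big1 ?addr0 ?subrK //.
by move=> i /negbTE ->; rewrite mul0r.
Qed.

Lemma noetherian_image (A B : comNzRingType) (f : {rmorphism A -> B}) :
  (forall b, exists a, f a = b) -> noetherian A -> noetherian B.
Proof.
move=> f_surj noethA I [I0 Iaxpy].
have [|k [g gP]] := noethA (fun a => I (f a)).
  by split=> [|r x y Ix Iy]; rewrite ?rmorph0 // rmorphD rmorphM; apply: Iaxpy.
exists k, (fun i => f (g i)) => x; split=> [|[c ->]].
  have [a <-] := f_surj x; move=> /gP[c ->]; exists (fun i => f (c i)).
  by rewrite rmorph_sum; apply: eq_bigr => i _; rewrite rmorphM.
have [c' c'P] := fin_all_exists (fun i => f_surj (c i)).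
have -> : \sum_i c i * f (g i) = f (\sum_i c' i * g i).
  by rewrite rmorph_sum; apply: eq_bigr => i _; rewrite rmorphM c'P.
by apply/gP; exists c'.
Qed.

(** * Quotient algebras *)

Section QuotientAlgebra.

Variables (K : fieldType) (C : comAlgType K) (I : C -> Prop).
Hypotheses (idealI : ideal I) (properI : ~ I 1).

(** The hypotheses on [I] are arguments, so that the ring structure of the quotient is
    inferred from the predicate alone. *)
Definition ideal_pred of ideal I & ~ I 1 : {pred C} :=
  fun c => excluded_middle_informative (I c).
Local Notation S := (ideal_pred idealI properI).

Lemma ideal_predP c : reflect (I c) (c \in S).
Proof.
by rewrite unfold_in /ideal_pred; case: excluded_middle_informative; constructor.
Qed.

Lemma ideal_pred_closed : idealr_closed S.
Proof.
case: idealI => I0 Iaxpy; split; [exact/ideal_predP | exact/ideal_predP|].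
by move=> r x y /ideal_predP Ix /ideal_predP Iy; apply/ideal_predP/Iaxpy.
Qed.

HB.instance Definition _ := isIdealr.Build C S ideal_pred_closed.

Definition quotient_ring : Type := {ideal_quot S}.
HB.instance Definition _ := GRing.ComNzRing.on quotient_ring.

Definition quotient_map : C -> quotient_ring := \pi_{ideal_quot S}%qT.
HB.instance Definition _ := GRing.RMorphism.copy quotient_map \pi_{ideal_quot S}%qT.

Lemma quotient_map_surj b : exists c, quotient_map c = b.
Proof. by exists (repr b); rewrite /quotient_map reprK. Qed.

Lemma quotient_map_eq0 c : quotient_map c = 0 <-> I c.
Proof.
rewrite -[0](rmorph0 quotient_map) (rwP (ideal_predP c)) -[c in c \in _]subr0.
by rewrite Quotient.idealrBE (rwP eqP).
Qed.

Definition quotient_scale (a : K) (b : quotient_ring) := quotient_map a%:A * b.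

Fact quotient_scaleA a b v :
  quotient_scale a (quotient_scale b v) = quotient_scale (a * b) v.
Proof. by rewrite /quotient_scale mulrA -rmorphM -scalerAl mul1r scalerA. Qed.

Fact quotient_scale1 : left_id 1 quotient_scale.
Proof. by move=> v; rewrite /quotient_scale scale1r rmorph1 mul1r. Qed.

Fact quotient_scaleDr : right_distributive quotient_scale +%R.
Proof. by move=> a u v; rewrite /quotient_scale mulrDr. Qed.

Fact quotient_scaleDl v : {morph quotient_scale^~ v : a b / a + b}.
Proof. by move=> a b; rewrite /quotient_scale scalerDl rmorphD mulrDl. Qed.

HB.instance Definition _ := GRing.Zmodule_isLmodule.Build K quotient_ring
  quotient_scaleA quotient_scale1 quotient_scaleDr quotient_scaleDl.

Fact quotient_scaleAl a (u v : quotient_ring) : a *: (u * v) = (a *: u) * v.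
Proof. exact: mulrA. Qed.

HB.instance Definition _ :=
  GRing.Lmodule_isLalgebra.Build K quotient_ring quotient_scaleAl.
HB.instance Definition _ := GRing.Lalgebra_isComAlgebra.Build K quotient_ring.

Fact quotient_map_scalable : scalable quotient_map.
Proof. by move=> a c; rewrite -[c in LHS]mul1r scalerAl rmorphM. Qed.

HB.instance Definition _ :=
  GRing.isScalable.Build K C quotient_ring *:%R quotient_map quotient_map_scalable.

End QuotientAlgebra.

Lemma quotient_algebra (K : fieldType) (C : comAlgType K) (I : C -> Prop) :
  ideal I -> ~ I 1 ->
  exists (B : comAlgType K) (pi : {lrmorphism C -> B}),
    (forall b, exists c, pi c = b) /\ (forall c, pi c = 0 <-> I c).
Proof.
move=> idealI properI.
exists (quotient_ring idealI properI).
exists (quotient_map idealI properI : {lrmorphism C -> _}).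
by split; [exact: quotient_map_surj | exact: quotient_map_eq0].
Qed.

(** Applying [psi] to a preimage under [pi] gives a result that depends only on the
    image, by the assumption on kernels. *)
Lemma lrmorphism_factor (K : fieldType) (C B A : comAlgType K)
    (pi : {lrmorphism C -> B}) (psi : {lrmorphism C -> A}) :
  (forall b, exists c, pi c = b) -> (forall c, pi c = 0 -> psi c = 0) ->
  exists phi : {lrmorphism B -> A}, forall c, phi (pi c) = psi c.
Proof.
move=> pi_surj ker_pi.
pose s b := proj1_sig (constructive_indefinite_description _ (pi_surj b)).
have sK b : pi (s b) = b by rewrite /s; case: constructive_indefinite_description.
pose phi b := psi (s b).
have phiE c : phi (pi c) = psi c.
  apply/subr0_eq; rewrite /phi -rmorphB; apply: ker_pi.
  by rewrite rmorphB /= sK subrr.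
have phiB : zmod_morphism phi.
  by move=> x y; rewrite -{1}(sK x) -{1}(sK y) -rmorphB phiE rmorphB.
have phiM : monoid_morphism phi.
  split=> [|x y]; first by rewrite -(rmorph1 pi) phiE rmorph1.
  by rewrite -{1}(sK x) -{1}(sK y) -rmorphM phiE rmorphM.
have phiZ : scalable phi.
  by move=> a x; rewrite -{1}(sK x) -linearZ phiE linearZ.
pose phi_add := GRing.isZmodMorphism.Build B A phi phiB.
pose phi_mul := GRing.isMonoidMorphism.Build B A phi phiM.
pose phi_scale := GRing.isScalable.Build K B A *:%R phi phiZ.
pose phiF : {lrmorphism B -> A} := HB.pack phi phi_add phi_mul phi_scale.
by exists phiF.
Qed.

(** * Representing objects *)

Lemma lrmorphism_eq (K : fieldType) (B A : comAlgType K)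
    (f g : {lrmorphism B -> A}) : f =1 g -> f = g.
Proof.
move=> /functional_extensionality; case: f g => [f fP] [g gP] /= eq_fg.
case: g / eq_fg in gP *; congr GRing.LRMorphism.Pack.
case: fP gP => [[a] [b] [c]] [[a'] [b'] [c']].
by congr (GRing.LRMorphism.Class _ _ _); congr (_ _); apply: proof_irrelevance.
Qed.

(** Yoneda's argument: the universal element of each algebra is classified over the
    other by a morphism, and naturality shows that a composite of the two morphisms
    classifies the same element as the identity. *)
Lemma represents_unique (K : fieldType) (F : set_functor K) (B B' : comAlgType K) :
  represents B F -> represents B' F -> isomorphic_algebras B B'.
Proof.
move=> [noethB [Phi [Phi_mem Phi_surj Phi_inj Phi_nat]]].
move=> [noethB' [Phi' [Phi'_mem Phi'_surj Phi'_inj Phi'_nat]]].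
have [f fP] := Phi'_surj _ _ noethB (Phi_mem B idfun noethB).
have [g gP] := Phi_surj _ _ noethB' (Phi'_mem B' idfun noethB').
have gf : g \o f =1 idfun.
  apply: (Phi'_inj _ (g \o f : {lrmorphism B' -> B'})) => //.
  rewrite (Phi'_nat _ _ g) // fP -(Phi_nat _ _ g idfun) // -gP.
  by congr Phi; apply: lrmorphism_eq.
have fg : f \o g =1 idfun.
  apply: (Phi_inj _ (f \o g : {lrmorphism B -> B})) => //.
  rewrite (Phi_nat _ _ f) // gP -(Phi'_nat _ _ f idfun) // -fP.
  by congr Phi'; apply: lrmorphism_eq.
by exists g, f => x; [apply: fg | apply: gf].
Qed.

Section Transfer.

Variables (K : fieldType) (F G : set_functor K).
Variable p : forall A : comAlgType K, fcar G A -> fcar F A.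
Arguments p {A}.

Hypothesis p_mem : forall (A : comAlgType K) (y : fcar G A), fmem y -> fmem (p y).
Hypothesis p_surj : forall (A : comAlgType K) (x : fcar F A), fmem x ->
  exists2 y, fmem y & p y = x.
Hypothesis p_inj : forall (A : comAlgType K) (y y' : fcar G A),
  fmem y -> fmem y' -> p y = p y' -> y = y'.
Hypothesis p_nat : forall (A A' : comAlgType K) (s : {lrmorphism A -> A'})
  (y : fcar G A), p (fmap s y) = fmap s (p y).

Lemma represents_of_lift (B : comAlgType K) : represents B G -> represents B F.
Proof.
move=> [noethB [Phi [Phi_mem Phi_surj Phi_inj Phi_nat]]]; split=> //.
exists (fun A phi => p (Phi A phi)); split.
- by move=> A phi noethA; apply/p_mem/Phi_mem.
- move=> A x noethA /p_surj[y /(Phi_surj _ _ noethA)[phi <-] <-].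
  by exists phi.
- move=> A phi psi noethA /p_inj eq_phi.
  by apply: (Phi_inj A) => //; apply: eq_phi; apply: Phi_mem.
- by move=> A A' s phi noethA noethA'; rewrite Phi_nat // p_nat.
Qed.

Hypothesis G_mem : forall (A A' : comAlgType K) (s : {lrmorphism A -> A'})
  (y : fcar G A), fmem y -> fmem (fmap s y).
Variable y0 : forall A : comAlgType K, fcar G A.

(** Lifting along [p] the elements classified by morphisms gives the classification
    for [G]; it is natural because lifts are unique. [y0] supplies its values at
    algebras that are not Noetherian, where it is arbitrary. *)
Lemma represents_lift (B : comAlgType K) : represents B F -> represents B G.
Proof.
move=> [noethB [Phi [Phi_mem Phi_surj Phi_inj Phi_nat]]]; split=> //.
have liftP (A : comAlgType K) (phi : {lrmorphism B -> A}) : exists y,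
    noetherian A -> fmem y /\ p y = Phi A phi.
  have [noethA|] := classic (noetherian A); last by exists (y0 A).
  by have [y] := p_surj (Phi_mem A phi noethA); exists y.
pose Psi (A : comAlgType K) (phi : {lrmorphism B -> A}) :=
   proj1_sig (constructive_indefinite_description _ (liftP A phi)).
have Psi_mem (A : comAlgType K) (phi : {lrmorphism B -> A}) :
    noetherian A -> fmem (Psi A phi).
  by rewrite /Psi; case: constructive_indefinite_description => y /= H /H[].
have pPsi (A : comAlgType K) (phi : {lrmorphism B -> A}) :
    noetherian A -> p (Psi A phi) = Phi A phi.
  by rewrite /Psi; case: constructive_indefinite_description => y /= H /H[].
exists Psi; split=> //.
- move=> A y noethA y_mem.
  have [phi phiP] := Phi_surj A _ noethA (p_mem y_mem).
  by exists phi; apply: p_inj => //; [apply: Psi_mem | rewrite pPsi].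
- move=> A phi psi noethA eq_phi.
  by apply: Phi_inj => //; rewrite -!pPsi // eq_phi.
- move=> A A' s phi noethA noethA'; apply: p_inj.
  + exact: Psi_mem.
  + by apply/G_mem/Psi_mem.
  + by rewrite p_nat !pPsi // Phi_nat.
Qed.

End Transfer.

(** * Coefficients of module elements *)

Section Coefficients.

Variables (n m : nat) (A : comNzRingType).
Implicit Types (u v : 'rV[{mpoly A[n.+1]}]_m) (b c : term n m).

Lemma coef_row0 b : coef (0 : 'rV[{mpoly A[n.+1]}]_m) b = 0.
Proof. by rewrite /coef mxE mcoeff0. Qed.

Lemma coef_rowD u v b : coef (u + v) b = coef u b + coef v b.
Proof. by rewrite /coef mxE mcoeffD. Qed.

Lemma coef_rowN u b : coef (- u) b = - coef u b.
Proof. by rewrite /coef mxE mcoeffN. Qed.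

Lemma coef_rowB u v b : coef (u - v) b = coef u b - coef v b.
Proof. by rewrite coef_rowD coef_rowN. Qed.

Lemma coef_row_sum (I : Type) (r : seq I) (Q : pred I)
    (f : I -> 'rV[{mpoly A[n.+1]}]_m) b :
  coef (\sum_(i <- r | Q i) f i) b = \sum_(i <- r | Q i) coef (f i) b.
Proof.
by apply: (big_morph (fun u => coef u b)) => [u v|];
  rewrite ?coef_rowD ?coef_row0.
Qed.

Lemma coef_rowZ (x : A) u b : coef (x%:MP *: u) b = x * coef u b.
Proof. by rewrite /coef mxE mcoeffCM. Qed.

Lemma coef_tvec b c : coef (tvec A b) c = (b == c)%:R.
Proof.
case: b c => [b k] [c l]; rewrite /coef /tvec !mxE /= xpair_eqE [l == k]eq_sym.
by case: (k == l); rewrite ?mulr1 ?mulr0 ?mcoeffX ?mcoeff0 ?andbT ?andbF.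
Qed.

Lemma coef_scale_tvec (q : {mpoly A[n.+1]}) a b :
  coef (q *: tvec A b) ((a + b.1)%MM, b.2) = q@_a.
Proof. by rewrite /coef /tvec scalerA !mxE /= !eqxx mulr1 addmC mcoeffMX. Qed.

Lemma row_coefP u v : (forall b, coef u b = coef v b) -> u = v.
Proof.
by move=> eq_uv; apply/rowP => k; apply/mpolyP => a; apply: (eq_uv (a, k)).
Qed.

Lemma scale_tvec a b : 'X_[a] *: tvec A b = tvec A ((a + b.1)%MM, b.2).
Proof. by rewrite /tvec scalerA mpolyXD. Qed.

Lemma coef_scale_neq0 (q : {mpoly A[n.+1]}) u b : coef (q *: u) b != 0 ->
  exists a c, [/\ q@_a != 0, coef u c != 0 & b = ((a + c.1)%MM, c.2)].
Proof.
case: b => b k; rewrite /coef mxE -mcoeff_msupp => /msuppM_le /allpairsP[[a c] /=].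
by rewrite !mcoeff_msupp => -[qa uc ->]; exists a, (c, k).
Qed.

(** Only stability under scalars of [A] is asked of [Q]: neither coefficients in the
    cones nor normal remainders survive multiplication by a variable. *)
Lemma row_span (Q : 'rV[{mpoly A[n.+1]}]_m -> Prop) u :
  Q 0 -> (forall x y, Q x -> Q y -> Q (x + y)) ->
  (forall (r : A) x, Q x -> Q (r%:MP *: x)) ->
  (forall b, coef u b != 0 -> Q (tvec A b)) -> Q u.
Proof.
move=> Q0 QD QZ Qu; rewrite [u]row_sum_delta; apply: (big_ind Q) => // k _.
rewrite [u 0 k]mpolyE scaler_suml big_seq; apply: (big_ind Q) => // a a_supp.
rewrite -mul_mpolyC -scalerA; apply/QZ/(Qu (a, k)).
by rewrite /coef /= -mcoeff_msupp.
Qed.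

End Coefficients.

Definition map_coefs (n k m : nat) (A A' : comNzRingType) (sigma : A -> A')
    (F : 'M[{mpoly A[n.+1]}]_(k, m)) : 'M[{mpoly A'[n.+1]}]_(k, m) :=
  map_mx (map_mpoly sigma) F.

Section MapCoefs.

Variables (n k l m : nat) (A A' : comNzRingType) (sigma : {rmorphism A -> A'}).

Lemma map_coefs_is_zmod_morphism :
  zmod_morphism (@map_coefs n k m A A' sigma).
Proof. by move=> F G; rewrite /map_coefs raddfB. Qed.

HB.instance Definition _ := GRing.isZmodMorphism.Build
  'M[{mpoly A[n.+1]}]_(k, m) 'M[{mpoly A'[n.+1]}]_(k, m)
  (@map_coefs n k m A A' sigma) map_coefs_is_zmod_morphism.

Lemma map_coefsM (w : 'M[{mpoly A[n.+1]}]_(l, k)) (F : 'M_(k, m)) :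
  map_coefs sigma (w *m F) = map_coefs sigma w *m map_coefs sigma F.
Proof. exact: map_mxM. Qed.

Lemma map_coefsZX a (F : 'M[{mpoly A[n.+1]}]_(k, m)) :
  map_coefs sigma ('X_[a] *: F) = 'X_[a] *: map_coefs sigma F.
Proof. by rewrite /map_coefs map_mxZ /= map_mpolyX. Qed.

Lemma row_map_coefs i (F : 'M[{mpoly A[n.+1]}]_(k, m)) :
  row i (map_coefs sigma F) = map_coefs sigma (row i F).
Proof. by rewrite /map_coefs map_row. Qed.

Lemma coef_map_coefs (u : 'rV[{mpoly A[n.+1]}]_m) (b : term n m) :
  coef (map_coefs sigma u) b = sigma (coef u b).
Proof. by rewrite /coef mxE mcoeff_map_mpoly. Qed.

Lemma map_coefs_tvec (b : term n m) : map_coefs sigma (tvec A b) = tvec A' b.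
Proof. by apply: row_coefP => c; rewrite coef_map_coefs !coef_tvec rmorph_nat. Qed.

End MapCoefs.

(** * The lexicographic order of cone cofactors *)

Section Cones.

Variable n : nat.
Implicit Types a b : 'X_{1..n.+1}.

Lemma mvar_min a (l : 'I_n.+1) : (l < mvar a)%N -> a l = 0%N.
Proof.
apply: contraTeq => al_neq0; rewrite -leqNgt /mvar.
case: pickP => [i /andP[_ /forallP/(_ l)]|/=]; first by rewrite al_neq0.
have [i ai_neq0 i_min] :=
  @arg_minnP _ l (fun i => a i != 0%N) (fun i : 'I_n.+1 => i : nat) al_neq0.
move=> /(_ i); rewrite ai_neq0 /= => /forallP[] j.
by apply/implyP => /i_min.
Qed.

Lemma mvar_U (i : 'I_n.+1) : mvar (U_(i)%MM : 'X_{1..n.+1}) = i.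
Proof.
rewrite /mvar; case: pickP => [j|/(_ i)] /=.
  by rewrite mnm1E eqb0 negbK => /andP[/eqP ->].
rewrite mnm1E eqxx /= => /forallP[] j; apply/implyP.
by rewrite mnm1E eqb0 negbK => /eqP ->.
Qed.

Lemma in_cone_addP m (p : term n m) a :
  reflect (forall i : 'I_n.+1, (mvar p.1 < i)%N -> a i = 0%N)
    (in_cone p ((a + p.1)%MM, p.2)).
Proof.
rewrite /in_cone /= eqxx lem_addl addmK /=.
apply: (iffP forallP) => H i; last by apply/implyP => /H ->.
by move=> lt_i; apply/eqP; move: (H i); rewrite lt_i.
Qed.

Lemma in_coneE m (p b : term n m) : in_cone p b ->
  exists a, b = ((a + p.1)%MM, p.2).
Proof.
case: b => b k /and3P[/= /eqP eq_k le_pb _].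
by exists (b - p.1)%MM; rewrite submK // eq_k.
Qed.

(** Tuples are compared from index 0 on, so the reversal makes the largest variable
    decide first. *)
Definition lexkey a : (n.+1).-tuplelexi nat := [tuple a (rev_ord i) | i < n.+1].

Lemma lexkey_inj : injective lexkey.
Proof.
move=> a b eq_ab; apply/mnmP => i.
have := congr1 (fun t => tnth t (rev_ord i)) eq_ab.
by rewrite !tnth_mktuple rev_ordK.
Qed.

Lemma ltn_rev_ord (i j : 'I_n.+1) : (rev_ord i < rev_ord j)%N = (j < i)%N.
Proof. by rewrite /= !subSS ltn_sub2lE // -ltnS. Qed.

Lemma lexkey_ltP a b : reflect
  (exists2 i : 'I_n.+1, (a i < b i)%N & forall j : 'I_n.+1, (i < j)%N -> a j = b j)
  (lexkey a < lexkey b)%O.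
Proof.
apply: (iffP ltxi_tuplePlt) => [[i eq_ab]|[i lt_ab eq_ab]].
  rewrite !tnth_mktuple => lt_ab; exists (rev_ord i) => // j lt_ij.
  have := eq_ab (rev_ord j); rewrite !tnth_mktuple !rev_ordK; apply.
  by rewrite -[i]rev_ordK ltn_rev_ord.
exists (rev_ord i) => [j lt_ji|]; rewrite !tnth_mktuple ?rev_ordK //.
by apply: eq_ab; rewrite -[i]rev_ordK ltn_rev_ord.
Qed.

Lemma lexkey_ind (Q : 'X_{1..n.+1} -> Prop) :
  (forall a, (forall b, (lexkey b < lexkey a)%O -> Q b) -> Q a) -> forall a, Q a.
Proof.
move=> IH a; move eq_t: (lexkey a) => t.
elim/(@ltxwf _ nat): t a eq_t => [R IHR x|t IHt a eq_t].
  by elim/ltn_ind: x => x IHx; apply: IHR => y; rewrite ltEnat; apply: IHx.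
by apply: IH => b; rewrite eq_t => lt_bt; apply: IHt lt_bt _ erefl.
Qed.

Lemma lexkey_max (T : eqType) (f : T -> 'X_{1..n.+1}) (r : seq T) : r != [::] ->
  exists2 x, x \in r & forall y, y \in r -> (lexkey (f y) <= lexkey (f x))%O.
Proof.
elim: r => // x [|y r] IHr _.
  by exists x => [|y]; rewrite inE // => /eqP ->.
have [//|z zr z_max] := IHr.
have [le_zx|lt_xz] := leP (lexkey (f z)) (lexkey (f x)).
  exists x; rewrite ?mem_head // => t; rewrite inE => /predU1P[->//|/z_max le_tz].
  exact: le_trans le_tz le_zx.
exists z => [|t]; first by rewrite in_cons zr orbT.
by rewrite inE => /predU1P[->|/z_max//]; apply: ltW.
Qed.

End Cones.

(** * Marked modules over a set of heads with disjoint Pommaret cones *)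

Section Stage.

Variables (n : nat) (s : stage n).
Implicit Types (a : 'X_{1..n.+1}) (b : term n (rank s)) (j : 'I_(size (heads s))).

Local Notation head_multiple a j := ((a + (head_term j).1)%MM, (head_term j).2).
Local Notation gen a j := ((a, j) : term n (size (heads s))).

Definition divisible b : bool :=
  [exists j, ((head_term j).2 == b.2) && ((head_term j).1 <= b.1)%MM].

(** The heads are the Pommaret basis of the monomial module they generate. *)
Definition cone_partition : Prop :=
  (forall b, divisible b -> exists j, in_cone (head_term j) b) /\
  (forall j j' b, in_cone (head_term j) b -> in_cone (head_term j') b -> j = j').

Definition normal (A : comNzRingType) (h : 'rV[{mpoly A[n.+1]}]_(rank s)) : Prop :=
  forall b, coef h b != 0 -> ~~ divisible b.

Definition marked_rows (A : comNzRingType)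
    (F : 'M[{mpoly A[n.+1]}]_(size (heads s), rank s)) : Prop :=
  forall j, normal (row j F - tvec A (head_term j)).

(** For marked rows this is the property of being a marked basis of the module that
    they generate, expressed through writings instead of complements so that it is
    visibly stable under extension of scalars. *)
Definition cone_closed (A : comNzRingType)
    (F : 'M[{mpoly A[n.+1]}]_(size (heads s), rank s)) : Prop :=
  forall v, exists2 w, cone_coefficients w & v *m F = w *m F.

Lemma divisible_head j a : divisible (head_multiple a j).
Proof. by apply/existsP; exists j; rewrite eqxx lem_addl. Qed.

(** Termination of the reduction: in [x^a q = x^a' p] with [q] normal and [p] a
    head whose cone contains the product, a variable above which [a] and [a'] agree
    and where [a'] exceeds [a] would be multiplicative for [p], and then [p] would
    divide [q]. *)
Lemma cone_cofactor_lt j a a' b : ~~ divisible b ->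
  in_cone (head_term j) (head_multiple a' j) ->
  (a + b.1)%MM = (a' + (head_term j).1)%MM -> b.2 = (head_term j).2 ->
  (lexkey a' < lexkey a)%O.
Proof.
set p := head_term j => b_normal /in_cone_addP a'_mult eq_ab eq_k.
have eq_i i : (a i + b.1 i = a' i + p.1 i)%N by rewrite -!mnmDE eq_ab.
rewrite ltNge; apply: contra b_normal => le_key.
apply/existsP; exists j; rewrite -/p eq_k eqxx /=; apply/mnm_lepP => l.
move: le_key; rewrite le_eqVlt => /predU1P[/lexkey_inj eq_a|].
  by move: (eq_i l); rewrite eq_a => /addnI ->.
case/lexkey_ltP => i lt_i eq_gt; case: (ltngtP l i) => [lt_l|gt_l|/ord_inj ->].
- rewrite (@mvar_min _ p.1 l) //; apply: leq_trans lt_l _.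
  rewrite leqNgt; apply: contraL lt_i => /a'_mult ->.
  by rewrite ltn0.
- by move: (eq_i l); rewrite eq_gt // => /addnI ->.
- by rewrite -(leq_add2l (a i)) eq_i leq_add2r ltnW.
Qed.

Section Rows.

Variable A : comNzRingType.
Implicit Types (u h : 'rV[{mpoly A[n.+1]}]_(rank s)).
Implicit Types (v w : 'rV[{mpoly A[n.+1]}]_(size (heads s))).
Implicit Types F : 'M[{mpoly A[n.+1]}]_(size (heads s), rank s).

Lemma normal0 : normal (0 : 'rV[{mpoly A[n.+1]}]_(rank s)).
Proof. by move=> b; rewrite coef_row0 eqxx. Qed.

Lemma normalD u h : normal u -> normal h -> normal (u + h).
Proof.
move=> Nu Nh b; rewrite coef_rowD; have [->|/Nu //] := eqVneq (coef u b) 0.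
by rewrite add0r => /Nh.
Qed.

Lemma normalZ (r : A) h : normal h -> normal (r%:MP *: h).
Proof.
move=> Nh b; rewrite coef_rowZ => rh; apply: Nh.
by apply: contraNneq rh => ->; rewrite mulr0.
Qed.

Lemma normal_tvec b : ~~ divisible b -> normal (tvec A b).
Proof.
by move=> Nb c; rewrite coef_tvec; case: (b =P c) => [<- //|_]; rewrite eqxx.
Qed.

Lemma cone_coefficients0 :
  cone_coefficients (0 : 'rV[{mpoly A[n.+1]}]_(size (heads s))).
Proof. by move=> l b; rewrite mxE mcoeff0 eqxx. Qed.

Lemma cone_coefficientsD v w :
  cone_coefficients v -> cone_coefficients w -> cone_coefficients (v + w).
Proof.
move=> Cv Cw l b; rewrite mxE mcoeffD.
have [->|/Cv //] := eqVneq (v 0 l)@_b 0.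
by rewrite add0r => /Cw.
Qed.

Lemma cone_coefficientsZ (r : A) w :
  cone_coefficients w -> cone_coefficients (r%:MP *: w).
Proof.
move=> Cw l b; rewrite mxE mcoeffCM => rw; apply: Cw.
by apply: contraNneq rw => ->; rewrite mulr0.
Qed.

Lemma cone_coefficientsB v w :
  cone_coefficients v -> cone_coefficients w -> cone_coefficients (v - w).
Proof.
move=> Cv Cw; apply: cone_coefficientsD => //.
by rewrite -scaleN1r -mpolyC1 -mpolyCN; apply: cone_coefficientsZ.
Qed.

Lemma cone_coefficients_tvec j a :
  in_cone (head_term j) (head_multiple a j) -> cone_coefficients (tvec A (gen a j)).
Proof.
move=> in_cone_a l b.
have := coef_tvec A (gen a j) (b, l).
rewrite /coef /= => ->; case: ((a, j) =P (b, l)) => [/pair_equal_spec[<- <-] //|_].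
by rewrite eqxx.
Qed.

Lemma tvec_mul F a j : tvec A (gen a j) *m F = 'X_[a] *: row j F.
Proof. by rewrite /tvec /= -scalemxAl -rowE. Qed.

Hypothesis cones : cone_partition.

(** Well-founded induction on the cofactor: [x^a p = x^a f_p - x^a (f_p - p)], and
    the terms of the last product lie in cones with smaller cofactors. *)
Lemma marked_span F u : marked_rows F ->
  exists w h, [/\ cone_coefficients w, normal h & u = w *m F + h].
Proof.
move=> markedF; pose Q u := exists w h,
  [/\ cone_coefficients w, normal h & u = w *m F + h].
have Q0 : Q 0.
  exists 0, 0; split; rewrite ?mul0mx ?addr0 //; last exact: normal0.
  exact: cone_coefficients0.
have QD x y : Q x -> Q y -> Q (x + y).
  move=> [w [h [Cw Nh ->]]] [w' [h' [Cw' Nh' ->]]]; exists (w + w'), (h + h').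
  split; [exact: cone_coefficientsD | exact: normalD |].
  by rewrite mulmxDl addrACA.
have QZ (r : A) x : Q x -> Q (r%:MP *: x).
  move=> [w [h [Cw Nh ->]]]; exists (r%:MP *: w), (r%:MP *: h).
  split; [exact: cone_coefficientsZ | exact: normalZ |].
  by rewrite scalerDr scalemxAl.
have QN b : ~~ divisible b -> Q (tvec A b).
  move=> Nb; exists 0, (tvec A b); rewrite mul0mx add0r.
  by split=> //; [exact: cone_coefficients0 | exact: normal_tvec].
have Qcone a : forall j, in_cone (head_term j) (head_multiple a j) ->
    Q (tvec A (head_multiple a j)).
  elim/lexkey_ind: a => a IHa j in_cone_a; set p := head_term j.
  have -> : tvec A ((a + p.1)%MM, p.2) =
      'X_[a] *: row j F + (-1)%:MP *: ('X_[a] *: (row j F - tvec A p)).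
    by rewrite -(scale_tvec A a p) mpolyCN mpolyC1 scaleN1r scalerBr subKr.
  apply/QD.
    exists (tvec A (gen a j)), 0; rewrite tvec_mul addr0.
    by split=> //; [exact: cone_coefficients_tvec | exact: normal0].
  apply/QZ; apply: (row_span (Q := Q)) => // c.
  move=> /coef_scale_neq0[a1 [b [a1_neq0 rb ->]]]; have Nb := markedF _ _ rb.
  move: a1_neq0; rewrite mcoeffX; case: (a =P a1) => [<- _|]; last by rewrite eqxx.
  have [/(proj1 cones)[j' in_cone_j']|] := boolP (divisible ((a + b.1)%MM, b.2)).
    have [a' eq_ab] := in_coneE in_cone_j'; rewrite eq_ab in in_cone_j' *.
    move/pair_equal_spec: eq_ab => [eq_ab eq_k]; apply: IHa => //.
    exact: cone_cofactor_lt Nb in_cone_j' eq_ab eq_k.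
  exact: QN.
apply: (row_span (Q := Q)) => // b _.
have [/(proj1 cones)[j in_cone_j]|/QN //] := boolP (divisible b).
by have [a eq_b] := in_coneE in_cone_j; rewrite eq_b in in_cone_j *; apply: Qcone.
Qed.

(** The term with the largest cofactor occurring in [w] produces a head multiple
    that no other summand of [w *m F] can cancel. *)
Lemma marked_independent F w : marked_rows F ->
  cone_coefficients w -> normal (w *m F) -> w = 0.
Proof.
move=> markedF Cw NwF.
pose r := [seq (a, j) | j <- enum 'I_(size (heads s)), a <- msupp (w 0 j)].
have rP a j : ((a, j) \in r) = ((w 0 j)@_a != 0).
  rewrite -mcoeff_msupp; apply/allpairsPdep/idP => [|aw].
    by case=> j' [a' [_ ? /pair_equal_spec[-> ->]]].
  by exists j, a; rewrite mem_enum.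
have [r_nil|r_neq0] := eqVneq r [::].
  apply/rowP => j; apply/mpolyP => a; rewrite mxE mcoeff0; apply/eqP.
  by rewrite -[_ == _]negbK -rP r_nil.
have [[a j] /= ar a_max] := lexkey_max (fun x => x.1) r_neq0.
have in_cone_a := Cw j a; rewrite -rP ar in in_cone_a; move/(_ isT) in in_cone_a.
set p := head_term j in in_cone_a; pose b : term n (rank s) := ((a + p.1)%MM, p.2).
suff /NwF : coef (w *m F) b != 0 by rewrite divisible_head.
have -> : w *m F = \sum_l (w 0 l *: tvec A (head_term l)) +
    \sum_l (w 0 l *: (row l F - tvec A (head_term l))).
  rewrite mulmx_sum_row -big_split /=; apply: eq_bigr => l _.
  by rewrite -scalerDr addrC subrK.
have coef_head l c : coef (w 0 l *: tvec A (head_term l)) c != 0 ->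
    in_cone (head_term l) c.
  case/coef_scale_neq0 => a1 [c1 [a1_neq0]]; rewrite coef_tvec.
  by case: (_ =P c1) => [<- _ ->|]; rewrite ?eqxx //; apply: Cw.
rewrite coef_rowD 2!coef_row_sum.
rewrite [X in X + _](bigD1 j isT).
(* The heads of the other rows contribute nothing, their cones being disjoint from
   the one that contains [b]. *)
rewrite [X in _ + X + _]big1 ?addr0 => [|l /= ne_lj]; last first.
  apply/eqP; apply: contraNT ne_lj => /coef_head in_cone_l.
  by rewrite (proj2 cones _ _ _ in_cone_l in_cone_a).
(* A normal term reaching [b] would have a cofactor larger than [a]. *)
rewrite big1 ?addr0 => [|l _]; last first.
  apply/eqP; apply: contraT => /coef_scale_neq0[a1 [c [a1_neq0 rc eq_b]]].
  have Nc := markedF _ _ rc.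
  have /= := a_max (a1, l); rewrite rP => /(_ a1_neq0); rewrite leNgt => /negP[].
  move/pair_equal_spec: eq_b => [eq_a eq_k].
  by apply: cone_cofactor_lt Nc in_cone_a _ _.
by rewrite coef_scale_tvec -rP.
Qed.

Lemma cone_closed_tvec F :
  (forall a j, exists2 w, cone_coefficients w & 'X_[a] *: row j F = w *m F) ->
  cone_closed F.
Proof.
move=> closedX v.
apply: (row_span (Q := fun v => exists2 w, cone_coefficients w & v *m F = w *m F)).
- by exists 0; rewrite ?mul0mx //; exact: cone_coefficients0.
- move=> x y [w Cw ew] [w' Cw' ew']; exists (w + w').
    exact: cone_coefficientsD.
  by rewrite !mulmxDl ew ew'.
- move=> r' x [w Cw ew]; exists (r'%:MP *: w); first exact: cone_coefficientsZ.
  by rewrite -!scalemxAl ew.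
- by move=> [a j] _; rewrite tvec_mul.
Qed.

Lemma cone_closed_normal F v : marked_rows F -> cone_closed F -> normal (v *m F) ->
  v *m F = 0.
Proof.
move=> markedF closedF; have [w Cw ->] := closedF v.
by move=> /(marked_independent markedF Cw) ->; rewrite mul0mx.
Qed.

Lemma normal_cone_closed F : marked_rows F ->
  (forall v, normal (v *m F) -> v *m F = 0) -> cone_closed F.
Proof.
move=> markedF F_normal v.
have [w [h [Cw Nh eq_v]]] := marked_span (v *m F) markedF.
exists w => //; apply/subr0_eq; rewrite -mulmxBl; apply: F_normal.
by rewrite mulmxBl eq_v addrC addKr.
Qed.

End Rows.

Section Map.

Variables (A A' : comNzRingType) (sigma : {rmorphism A -> A'}).

Lemma normal_map (h : 'rV[{mpoly A[n.+1]}]_(rank s)) :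
  normal h -> normal (map_coefs sigma h).
Proof.
move=> Nh b; rewrite coef_map_coefs => sh; apply: Nh.
by apply: contraNneq sh => ->; rewrite rmorph0.
Qed.

Lemma cone_coefficients_map (w : 'rV[{mpoly A[n.+1]}]_(size (heads s))) :
  cone_coefficients w -> cone_coefficients (map_coefs sigma w).
Proof.
move=> Cw l b; rewrite mxE mcoeff_map_mpoly => sw; apply: Cw.
by apply: contraNneq sw => ->; rewrite raddf0.
Qed.

Lemma marked_rows_map (F : 'M[{mpoly A[n.+1]}]_(size (heads s), rank s)) :
  marked_rows F -> marked_rows (map_coefs sigma F).
Proof.
move=> markedF j; rewrite row_map_coefs -(map_coefs_tvec sigma) -raddfB.
exact: normal_map.
Qed.

Lemma cone_closed_map (F : 'M[{mpoly A[n.+1]}]_(size (heads s), rank s)) :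
  cone_closed F -> cone_closed (map_coefs sigma F).
Proof.
move=> closedF; apply: cone_closed_tvec => a j.
have [w Cw] := closedF (tvec A (gen a j)).
rewrite tvec_mul => eq_w; exists (map_coefs sigma w).
  exact: cone_coefficients_map.
by rewrite row_map_coefs -map_coefsZX eq_w map_coefsM.
Qed.

End Map.

End Stage.

(** * Fundamental syzygies *)

Section NextStage.

Variables (n : nat) (s : stage n).
Let s' := next_stage s.

Lemma mem_next_heads (i : 'I_n.+1) (j : 'I_(size (heads s))) :
  ((U_(i)%MM, j) \in heads s') = (mvar (head_term j).1 < i)%N.
Proof.
apply/allpairsPdep/idP => [[j' [i' [_]]]|lt_i].
  rewrite mem_filter => /andP[lt_i' _] /pair_equal_spec[/eqP].
  by rewrite eq_mnm1 => /eqP -> ->.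
by exists j, i; rewrite mem_enum mem_filter mem_enum lt_i.
Qed.

Lemma next_headsP (l : 'I_(size (heads s'))) :
  exists (i : 'I_n.+1) (j : 'I_(size (heads s))),
  head_term l = (U_(i)%MM, j) /\ (mvar (head_term j).1 < i)%N.
Proof.
have /allpairsPdep[j [i [_]]] := mem_tnth l (in_tuple (heads s')).
by rewrite mem_filter => /andP[lt_i _] eq_l; exists i, j.
Qed.

Lemma next_heads_uniq : uniq (heads s').
Proof.
apply: allpairs_uniq_dep => [|j _|[j i] [j' i'] _ _ /= /pair_equal_spec[/eqP]].
- exact: enum_uniq.
- by rewrite filter_uniq // enum_uniq.
by rewrite eq_mnm1 => /eqP -> ->.
Qed.

Lemma divisible_next a (j : 'I_(size (heads s))) :
  divisible (s := s') (a, j) =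
  ~~ in_cone (head_term j) ((a + (head_term j).1)%MM, (head_term j).2).
Proof.
apply/existsP/idP => [[l]|].
  have [i [j' [-> lt_i]]] := next_headsP l; rewrite /= lep1mP => /andP[/eqP <- ai].
  by apply/in_cone_addP => /(_ i lt_i)/eqP; apply/negP.
move=> not_cone; have [i /andP[lt_i ai]] : exists i : 'I_n.+1,
    (mvar (head_term j).1 < i)%N && (a i != 0%N).
  apply/existsP; apply: contraR not_cone; rewrite negb_exists => /forallP a_mult.
  by apply/in_cone_addP => i lt_i; apply/eqP; move: (a_mult i); rewrite lt_i negbK.
move: lt_i; rewrite -mem_next_heads => /(tnthP (in_tuple (heads s')))[l eq_l].
exists l.
by rewrite /head_term -eq_l eqxx lep1mP.
Qed.

(** A multiple [x^a f_j] lies in the cone of [x_i f_j] for [i] the largest variable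
    of [a], and in no other one. *)
Lemma cone_partition_next : cone_partition s'.
Proof.
have coneP (l : 'I_(size (heads s'))) i (j k : 'I_(size (heads s))) a :
    head_term l = (U_(i)%MM, j) -> in_cone (head_term l) (a, k) =
    [&& j == k, a i != 0%N & [forall i' : 'I_n.+1, (i < i')%N ==> (a i' == 0%N)]].
  move=> ->; rewrite /in_cone /= mvar_U lep1mP; case: (j == k) => //=.
  case: (a i != 0%N) => //=; apply: eq_forallb => i'; case: ltnP => //= lt_i.
  by rewrite mnmBE mnm1E -val_eqE /= (ltn_eqF lt_i) subn0.
split=> [[a j] /existsP[l]|l l' [a k]].
  have [i [j' [-> lt_i]]] := next_headsP l.
  rewrite /= lep1mP => /andP[/eqP eq_j ai]; rewrite {j'}eq_j in lt_i.
  have [i1 ai1 i1_max] :=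
    @arg_maxnP _ i (fun i => a i != 0%N) (fun i : 'I_n.+1 => i : nat) ai.
  have := leq_trans lt_i (i1_max i ai).
  rewrite -mem_next_heads => /(tnthP (in_tuple (heads s')))[l1 eq_l1]; exists l1.
  rewrite (coneP l1 i1 j j) ?eqxx ?ai1 //=; apply/forallP => i2; apply/implyP.
  by apply: contraTT => /i1_max; rewrite -leqNgt.
have [i [j [eq_l _]]] := next_headsP l; have [i' [j' [eq_l' _]]] := next_headsP l'.
rewrite (coneP _ _ _ _ _ eq_l) (coneP _ _ _ _ _ eq_l').
move=> /and3P[/eqP <- ai /forallP i_max] /and3P[/eqP eq_j ai' /forallP i'_max].
have le_ii' : (i <= i')%N.
  by rewrite leqNgt; apply: contraL ai => /(implyP (i'_max i)) ->.
have le_i'i : (i' <= i)%N.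
  by rewrite leqNgt; apply: contraL ai' => /(implyP (i_max i')) ->.
apply: (elimT (tuple_uniqP (in_tuple (heads s'))) next_heads_uniq).
rewrite -/(head_term l) -/(head_term l') eq_l eq_l' eq_j.
by have -> // : i = i' by apply/val_inj/anti_leq; rewrite le_ii' le_i'i.
Qed.

Section Rows.

Variable A : comNzRingType.
Implicit Types (F : 'M[{mpoly A[n.+1]}]_(size (heads s), rank s)).
Implicit Types (G : 'M[{mpoly A[n.+1]}]_(size (heads s'), rank s')).

(** The link between consecutive stages: a vector of coefficients is reduced for the
    syzygies exactly when it is one of those for which writings are unique. *)
Lemma normal_nextE (w : 'rV[{mpoly A[n.+1]}]_(size (heads s))) :
  normal (s := s') w <-> cone_coefficients w.
Proof.
split=> [Nw l b wb|Cw [b l]].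
  by have := Nw (b, l) wb; rewrite divisible_next negbK.
by rewrite divisible_next negbK; apply: Cw.
Qed.

Lemma fundamental_syzygies_exist F : cone_closed F ->
  exists G : 'M[{mpoly A[n.+1]}]_(size (heads s'), rank s'),
    fundamental_syzygies F G.
Proof.
move=> closedF.
have /fin_all_exists[w wP] : forall l : 'I_(size (heads s')),
    exists w : 'rV[{mpoly A[n.+1]}]_(size (heads s)),
    cone_coefficients w /\ 'X_[(head_term l).1] *: row (head_term l).2 F = w *m F.
  move=> l; have [w Cw] := closedF (tvec A ((head_term l).1, (head_term l).2)).
  by rewrite tvec_mul; exists w.
exists (\matrix_l (tvec A (head_term l) - w l)) => l.
by exists (w l); case: (wP l); rewrite rowK.
Qed.

Hypothesis cones : cone_partition s.

Section Syzygies.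

Variables (F : 'M[{mpoly A[n.+1]}]_(size (heads s), rank s)).
Variables (G : 'M[{mpoly A[n.+1]}]_(size (heads s'), rank s')).
Hypotheses (markedF : marked_rows F) (GP : fundamental_syzygies F G).

Lemma fundamental_syzygies_marked : marked_rows G.
Proof.
move=> l; have [w [Cw _ ->]] := GP l; rewrite addrC addKr.
by apply/normal_nextE; rewrite -sub0r; apply: cone_coefficientsB => //;
  exact: cone_coefficients0.
Qed.

Lemma fundamental_syzygies_mul : G *m F = 0.
Proof.
apply/row_matrixP => l; rewrite row_mul row0; have [w [_ eq_w ->]] := GP l.
by rewrite mulmxBl -eq_w [head_term l]surjective_pairing tvec_mul subrr.
Qed.

(** The remainder of a syzygy modulo [G] is a syzygy with coefficients in the cones,
    hence it vanishes by uniqueness of such writings. *)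
Lemma syzygy_cone_writing w : syzygies F w ->
  exists2 v, cone_coefficients (s := s') v & w = v *m G.
Proof.
move=> syz_w.
have [v [h [Cv Nh eq_w]]] :=
  marked_span cone_partition_next w fundamental_syzygies_marked.
exists v => //; rewrite eq_w; have -> : h = 0; last by rewrite addr0.
apply: (marked_independent cones markedF); first exact/normal_nextE.
have -> : h *m F = 0; last exact: normal0.
move: syz_w; rewrite /syzygies eq_w mulmxDl -mulmxA fundamental_syzygies_mul.
by rewrite mulmx0 add0r.
Qed.

Lemma fundamental_syzygies_generate : generated_by_rows G (syzygies F).
Proof.
move=> w; split=> [/syzygy_cone_writing[v _ ->]|[v ->]]; first by exists v.
by rewrite /syzygies -mulmxA fundamental_syzygies_mul mulmx0.
Qed.

Lemma fundamental_syzygies_closed : cone_closed G.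
Proof.
move=> v; apply: syzygy_cone_writing.
by apply/fundamental_syzygies_generate; exists v.
Qed.

End Syzygies.

Lemma fundamental_syzygies_unique F G G' : marked_rows F ->
  fundamental_syzygies F G -> fundamental_syzygies F G' -> G = G'.
Proof.
move=> markedF GP G'P; apply/row_matrixP => l.
have [w [Cw eq_w ->]] := GP l; have [w' [Cw' eq_w' ->]] := G'P l.
congr (_ - _); apply/subr0_eq; apply: (marked_independent cones markedF).
  exact: cone_coefficientsB.
by rewrite mulmxBl -eq_w -eq_w' subrr; apply: normal0.
Qed.

End Rows.

Lemma fundamental_syzygies_map (A A' : comNzRingType) (sigma : {rmorphism A -> A'})
    (F : 'M[{mpoly A[n.+1]}]_(size (heads s), rank s))
    (G : 'M[{mpoly A[n.+1]}]_(size (heads s'), rank s')) :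
  fundamental_syzygies F G ->
  fundamental_syzygies (map_coefs sigma F) (map_coefs sigma G).
Proof.
move=> GP l; have [w [Cw eq_w eq_G]] := GP l; exists (map_coefs sigma w); split.
- exact: cone_coefficients_map.
- by rewrite row_map_coefs -map_coefsZX eq_w map_coefsM.
- by rewrite row_map_coefs eq_G raddfB /= map_coefs_tvec.
Qed.

End NextStage.

(** * Marked bases and extension of scalars *)

Section Submodules.

Variables (n m : nat) (A : comNzRingType) (d : 'I_m -> int).
Implicit Types (M : 'rV[{mpoly A[n.+1]}]_m -> Prop) (u v : 'rV[{mpoly A[n.+1]}]_m).

Lemma submodule_mul k (F : 'M[{mpoly A[n.+1]}]_(k, m)) M w :
  submodule M -> (forall i, M (row i F)) -> M (w *m F).
Proof.
move=> [M0 Mlin] MF; rewrite mulmx_sum_row.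
apply: (big_ind M) => // [u v Mu Mv|i _].
  by rewrite -[u]scale1r; apply: Mlin.
by rewrite -[_ *: _]addr0; apply: Mlin.
Qed.

Lemma generated_submodule k (F : 'M[{mpoly A[n.+1]}]_(k, m)) M :
  generated_by_rows F M -> submodule M.
Proof.
move=> genM; split; first by apply/genM; exists 0; rewrite mul0mx.
move=> r u v /genM[w ->] /genM[w' ->]; apply/genM; exists (r *: w + w').
by rewrite mulmxDl scalemxAl.
Qed.

Lemma submoduleB M u v : submodule M -> M u -> M v -> M (u - v).
Proof. by move=> [_ Mlin] Mu Mv; rewrite addrC -scaleN1r; apply: Mlin. Qed.

Definition term_degree (b : term n m) : int := Posz (mdeg b.1) + d b.2.

(** In a decomposition of [u] into homogeneous elements of [M], the summands of degree
    [e] add up to the component of degree [e]. *)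
Lemma graded_component M u e : submodule M -> graded d M -> M u ->
  exists2 v, M v & forall b, coef v b = if term_degree b == e then coef u b else 0.
Proof.
move=> subM gradedM /gradedM[r rP ->]; elim: r rP => [|x r IHr] rP.
  by exists 0 => [|b]; [case: subM | rewrite big_nil coef_row0 if_same].
have [y yr|v Mv vE] := IHr; first by apply: rP; rewrite inE yr orbT.
have [Mx [e' x_homog]] := rP x (mem_head x r).
have [eq_e|ne_e] := eqVneq e' e.
  exists (x + v) => [|b]; first by rewrite -[x]scale1r; apply: (proj2 subM).
  rewrite big_cons !coef_rowD vE; case: ifP => // ne_be; rewrite addr0.
  apply/eqP; apply: contraFT ne_be => /x_homog.
  by rewrite /term_degree eq_e => ->.
exists v => // b; rewrite big_cons coef_rowD vE; case: ifP => // /eqP eq_be.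
suff -> : coef x b = 0 by rewrite add0r.
apply/eqP; apply: contraNT ne_e => /x_homog <-.
exact/eqP.
Qed.

Lemma generated_graded k (F : 'M[{mpoly A[n.+1]}]_(k, m)) M :
  generated_by_rows F M -> (forall i, exists e, homogeneous d e (row i F)) ->
  graded d M.
Proof.
move=> genM homF u /genM[w ->].
exists [seq ((w 0 i)@_a)%:MP *: ('X_[a] *: row i F)
       | i <- enum 'I_k, a <- msupp (w 0 i)].
  move=> _ /allpairsPdep[i [a [_ _ ->]]]; split.
    apply/genM; exists (((w 0 i)@_a)%:MP *: ('X_[a] *: delta_mx 0 i)).
    by rewrite -!scalemxAl -rowE.
  have [e homFi] := homF i; exists (Posz (mdeg a) + e) => b.
  rewrite coef_rowZ => wb.
  have /coef_scale_neq0[a' [c [a'_neq0 Fc ->]]] : coef ('X_[a] *: row i F) b != 0.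
    by apply: contraNneq wb => ->; rewrite mulr0.
  move: a'_neq0; rewrite mcoeffX; case: (a =P a') => [<- _|]; last by rewrite eqxx.
  by rewrite mdegD PoszD -addrA (homFi c Fc).
rewrite big_allpairs_dep mulmx_sum_row big_enum /=; apply: eq_bigr => i _.
rewrite {1}[w 0 i]mpolyE scaler_suml; apply: eq_bigr => a _.
by rewrite scalerA mul_mpolyC.
Qed.

End Submodules.

Lemma extend_scalars_generated (n k m : nat) (A A' : comNzRingType)
    (sigma : {rmorphism A -> A'}) (F : 'M[{mpoly A[n.+1]}]_(k, m)) M :
  generated_by_rows F M ->
  generated_by_rows (map_coefs sigma F) (extend_scalars sigma M).
Proof.
move=> genM u; split=> [[l [V [c [MV ->]]]]|[w ->]].
  have /fin_all_exists[w wP] : forall i, exists w, row i V = w *m F.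
    by move=> i; apply/genM/MV.
  have -> : V = \matrix_i w i *m F.
    by apply/row_matrixP => i; rewrite row_mul rowK.
  exists (c *m map_coefs sigma (\matrix_i w i)).
  by rewrite -mulmxA -map_coefsM.
exists k, F, w; split=> // i; apply/genM; exists (delta_mx 0 i).
by rewrite -rowE.
Qed.

Section MarkedBases.

Variables (K : fieldType) (n m : nat) (d : 'I_m -> int).
Variables (U : 'rV[{mpoly K[n.+1]}]_m -> Prop) (P : seq (term n m)).
Hypothesis HP : pommaret_basis U P.

Let s0 := Stage P.

Lemma in_cone_refl (p : term n m) : in_cone p p.
Proof.
case: p => p k; rewrite -{2}[p]add0m.
by apply/(in_cone_addP (p, k)) => i _; rewrite mnm0E.
Qed.

Lemma pommaret_divisible b : U (tvec K b) <-> divisible (s := s0) b.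
Proof.
case: HP => _ genU coneU U_cone; split.
  case/U_cone=> p [[/(tnthP (in_tuple P))[j ->] /and3P[? ? _]] _].
  by apply/existsP; exists j; rewrite /head_term; apply/andP.
case/existsP => j /andP[/eqP eq_k le_jb].
have -> : tvec K b = 'X_[b.1 - (head_term j).1] *: tvec K (head_term j).
  by rewrite scale_tvec (submK le_jb) eq_k -surjective_pairing.
rewrite -[_ *: _]addr0; apply: (proj2 (generated_submodule genU)).
  by apply: coneU (in_cone_refl _); apply: mem_tnth.
by case: (generated_submodule genU).
Qed.

Lemma pommaret_cone_partition : cone_partition s0.
Proof.
case: (HP) => uniqP _ _ U_cone.
split=> [b /pommaret_divisible/U_cone[p [[pP ?] _]]|j j' b bj bj'].
  by move: pP => /(tnthP (in_tuple P))[j eq_p]; exists j; rewrite /head_term -eq_p.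
have /pommaret_divisible/U_cone[p [_ p_uniq]] : divisible (s := s0) b.
  by case/and3P: bj => ? ? _; apply/existsP; exists j; apply/andP.
apply: (elimT (tuple_uniqP (in_tuple P)) uniqP).
have memP l : head_term (s := s0) l \in P by apply: mem_tnth.
exact: etrans (esym (p_uniq _ (conj (memP j) bj))) (p_uniq _ (conj (memP j') bj')).
Qed.

Lemma pommaret_normal (A : comNzRingType) (h : 'rV[{mpoly A[n.+1]}]_m) :
  normal_span U h <-> normal (s := s0) h.
Proof.
split=> Nh b /Nh; first by move=> Nb; apply/negP => /pommaret_divisible.
by move/negP=> Nb /pommaret_divisible.
Qed.

Section Ring.

Variable A : comNzRingType.
Implicit Types (M : 'rV[{mpoly A[n.+1]}]_m -> Prop).
Implicit Types (F : 'M[{mpoly A[n.+1]}]_(size P, m)).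

Lemma marked_set_rows F : marked_set d U F -> marked_rows (s := s0) F.
Proof. by move=> markedF j; apply/pommaret_normal; case: (markedF j). Qed.

Lemma marked_row_head F j : marked_rows (s := s0) F ->
  coef (row j F) (tnth (in_tuple P) j) = 1.
Proof.
move=> markedF; apply/subr0_eq/eqP.
have /eqP <- : (coef (tvec A (tnth (in_tuple P) j)) (tnth (in_tuple P) j) == 1).
  by rewrite coef_tvec eqxx.
rewrite -coef_rowB; apply: contraT => /markedF /negP[].
apply/existsP; exists j; rewrite eqxx; exact: lepm_refl.
Qed.

Lemma marked_set_intro F : marked_rows (s := s0) F ->
  (forall j, homogeneous d (term_degree d (tnth (in_tuple P) j)) (row j F)) ->
  marked_set d U F.
Proof.
move=> markedF homF j /=; split; last exact/pommaret_normal/markedF.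
  by exists (term_degree d (tnth (in_tuple P) j)).
exact: marked_row_head.
Qed.

Lemma marked_set_homogeneous F j : marked_set d U F ->
  homogeneous d (term_degree d (tnth (in_tuple P) j)) (row j F).
Proof.
move=> /(_ j)[[e homF] head_j _].
suff -> : term_degree d (tnth (in_tuple P) j) = e by [].
by apply: homF; rewrite head_j oner_eq0.
Qed.

Lemma marked_basis_intro F M : marked_set d U F -> cone_closed (s := s0) F ->
  generated_by_rows F M -> marked_basis d U F M.
Proof.
move=> markedF closedF genM; have rowsF := marked_set_rows markedF.
split=> //; split=> [u|u /genM[v ->]].
  have [w [h [_ Nh ->]]] := marked_span pommaret_cone_partition u rowsF.
  by exists (w *m F), h; split=> //; [apply/genM; exists w | apply/pommaret_normal].
move/pommaret_normal.
exact: (cone_closed_normal pommaret_cone_partition rowsF closedF).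
Qed.

Lemma marked_basis_closed F M : marked_basis d U F M -> cone_closed (s := s0) F.
Proof.
case=> markedF genM [_ M_normal].
apply: (normal_cone_closed pommaret_cone_partition (marked_set_rows markedF)).
move=> v /pommaret_normal Nv; apply: M_normal Nv.
by apply/genM; exists v.
Qed.

Lemma marked_basis_unique F F' M :
  marked_basis d U F M -> marked_basis d U F' M -> F = F'.
Proof.
case=> markedF genM [_ M_normal] [markedF' genM' _]; apply/row_matrixP => j.
apply/subr0_eq/M_normal.
  apply: submoduleB (generated_submodule genM) _ _; [apply/genM | apply/genM'];
  by exists (delta_mx 0 j); rewrite -rowE.
apply/pommaret_normal => b.
have -> : row j F - row j F' = (row j F - tvec A (tnth (in_tuple P) j)) +
    (-1)%:MP *: (row j F' - tvec A (tnth (in_tuple P) j)).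
  by rewrite mpolyCN mpolyC1 scaleN1r opprB addrA subrK.
by apply: normalD; [|apply: normalZ]; apply: marked_set_rows.
Qed.

End Ring.

(** The marked element with head [p] is the component of degree [deg p] of the part of
    [p] in [M]: removing the other components leaves the rest of [p] normal. *)
Lemma mf_mem_marked_basis (A : comAlgType K) (M : 'rV[{mpoly A[n.+1]}]_m -> Prop) :
  mf_mem d U M <-> exists F : 'M[{mpoly A[n.+1]}]_(size P, m), marked_basis d U F M.
Proof.
split=> [[subM gradedM [M_span M_normal]]|[F [markedF genM complM]]]; last first.
  split=> //; first exact: generated_submodule genM.
  by apply: generated_graded genM _ => j; case: (markedF j).
have /fin_all_exists[f fP] : forall j, exists f, [/\ M f,
    homogeneous d (term_degree d (tnth (in_tuple P) j)) f &
    normal (s := s0) (f - tvec A (tnth (in_tuple P) j))].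
  move=> j; set p := tnth _ j; have [v [h [Mv Nh eq_vh]]] := M_span (tvec A p).
  have [f Mf fE] := graded_component (term_degree d p) subM gradedM Mv.
  exists f; split=> // b; rewrite ?coef_rowB fE.
    by case: ifP => [/eqP //|_]; rewrite eqxx.
  case: ifPn => [_|/eqP ne_deg].
    rewrite eq_vh coef_rowD opprD addrA subrr add0r oppr_eq0 => hb.
    by apply/negP => /pommaret_divisible; apply: Nh hb.
  rewrite coef_tvec; case: (p =P b) => [eq_pb|_]; last by rewrite subrr eqxx.
  by case: ne_deg; rewrite eq_pb.
pose F : 'M[{mpoly A[n.+1]}]_(size P, m) := \matrix_j f j.
have markedF : marked_rows (s := s0) F by move=> j; rewrite rowK; case: (fP j).
have MF j : M (row j F) by rewrite rowK; case: (fP j).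
exists F; split=> //.
  by apply: marked_set_intro => // j; rewrite rowK; case: (fP j).
move=> u; split=> [Mu|[w ->]]; last exact: submodule_mul.
have [w [h [_ Nh eq_u]]] := marked_span pommaret_cone_partition u markedF.
exists w; rewrite eq_u -[RHS]addr0; congr (_ + _).
apply: M_normal; last exact/pommaret_normal.
have -> : h = u - w *m F by rewrite eq_u addrC addKr.
by apply: submoduleB => //; apply: submodule_mul.
Qed.

Section Map.

Variables (A A' : comNzRingType) (sigma : {rmorphism A -> A'}).

Lemma marked_set_map (F : 'M[{mpoly A[n.+1]}]_(size P, m)) :
  marked_set d U F -> marked_set d U (map_coefs sigma F).
Proof.
move=> markedF; apply: marked_set_intro.
  by apply: (marked_rows_map (s := s0)); apply: marked_set_rows.
move=> j b; rewrite row_map_coefs coef_map_coefs => sb.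
apply: (marked_set_homogeneous markedF).
by apply: contraNneq sb => ->; rewrite rmorph0.
Qed.

Lemma marked_basis_map (F : 'M[{mpoly A[n.+1]}]_(size P, m)) M :
  marked_basis d U F M ->
  marked_basis d U (map_coefs sigma F) (extend_scalars sigma M).
Proof.
move=> basisF; case: (basisF) => markedF genM _; apply: marked_basis_intro.
- exact: marked_set_map.
- by apply: (cone_closed_map (s := s0)); apply: marked_basis_closed basisF.
- exact: extend_scalars_generated.
Qed.

End Map.

End MarkedBases.

(** * The syzygy and resolution functors *)

Lemma predicate_ext (T : Type) (Q R : T -> Prop) : (forall x, Q x <-> R x) -> Q = R.
Proof.
move=> QR; apply: functional_extensionality => x.
exact: propositional_extensionality.
Qed.

(** Both sides are generated by the fundamental syzygies, and these commute with
    [sigma]. *)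
Lemma extend_scalars_syzygies (n : nat) (s : stage n) (A A' : comNzRingType)
    (sigma : {rmorphism A -> A'})
    (F : 'M[{mpoly A[n.+1]}]_(size (heads s), rank s)) S :
  cone_partition s -> marked_rows F -> cone_closed F ->
  (forall w, S w <-> syzygies F w) ->
  forall w, extend_scalars sigma S w <-> syzygies (map_coefs sigma F) w.
Proof.
move=> cones markedF closedF SP w.
have [G GP] := fundamental_syzygies_exist closedF.
have genG : generated_by_rows G S.
  move=> v; apply: iff_trans (SP v) _.
  exact: (fundamental_syzygies_generate cones markedF GP).
apply: iff_trans (extend_scalars_generated sigma genG w) _; apply: iff_sym.
exact: (fundamental_syzygies_generate cones
  (marked_rows_map (sigma := sigma) markedF) (fundamental_syzygies_map sigma GP)).
Qed.

Section Resolution.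

Variables (n m : nat) (P : seq (term n m)) (A : comNzRingType).

Definition resolution : Type :=
  forall t, 'M[{mpoly A[n.+1]}]_(size (heads (stages P t)), rank (stages P t)).
Implicit Types F : resolution.

Hypothesis cones : cone_partition (stages P 0).

Lemma stages_cone_partition t : cone_partition (stages P t).
Proof. by case: t => [|t] //; apply: cone_partition_next. Qed.

Lemma resolution_marked F t : marked_rows (F 0%N) -> cone_closed (F 0%N) ->
  (forall t, fundamental_syzygies (F t) (F t.+1)) ->
  marked_rows (F t) /\ cone_closed (F t).
Proof.
move=> marked0 closed0 FP; elim: t => [|t [markedF closedF]] //; split.
  exact: fundamental_syzygies_marked (FP t).
exact: (fundamental_syzygies_closed (stages_cone_partition t) markedF (FP t)).
Qed.

(** A stage has fundamental syzygies because it is a marked basis, so the recursion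
    carries this property along. *)
Lemma resolution_exists (F0 : 'M[{mpoly A[n.+1]}]_(size P, m)) :
  marked_rows (s := stages P 0) F0 -> cone_closed (s := stages P 0) F0 ->
  exists2 F : resolution, F 0%N = F0 &
    forall t, fundamental_syzygies (F t) (F t.+1).
Proof.
move=> marked0 closed0.
pose good t
    (F : 'M[{mpoly A[n.+1]}]_(size (heads (stages P t)), rank (stages P t))) :=
  marked_rows F /\ cone_closed F.
have next t (x : sig (good t)) : exists y : sig (good t.+1),
    fundamental_syzygies (sval x) (sval y).
  case: x => F [markedF closedF]; have [G GP] := fundamental_syzygies_exist closedF.
  have goodG : good t.+1 G.
    split; first exact: fundamental_syzygies_marked GP.
    exact: (fundamental_syzygies_closed (stages_cone_partition t) markedF GP).
  by exists (exist _ G goodG).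
pose step t x := proj1_sig (constructive_indefinite_description _ (next t x)).
pose x0 : sig (good 0%N) := exist (good 0%N) F0 (conj marked0 closed0).
pose x := nat_rect (fun t => sig (good t)) x0 step.
exists (fun t => sval (x t)) => // t.
exact: (proj2_sig (constructive_indefinite_description _ (next t (x t)))).
Qed.

Lemma resolution_unique F F' t : F 0%N = F' 0%N ->
  marked_rows (F 0%N) -> cone_closed (F 0%N) ->
  (forall t, fundamental_syzygies (F t) (F t.+1)) ->
  (forall t, fundamental_syzygies (F' t) (F' t.+1)) -> F t = F' t.
Proof.
move=> eq0 marked0 closed0 FP F'P; elim: t => // t eq_t.
have [markedF _] := resolution_marked t marked0 closed0 FP.
apply: (fundamental_syzygies_unique (stages_cone_partition t) markedF (FP t)).
by rewrite eq_t; apply: F'P.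
Qed.

End Resolution.

Section Functors.

Variables (K : fieldType) (n m : nat) (d : 'I_m -> int).
Variables (U : 'rV[{mpoly K[n.+1]}]_m -> Prop) (P : seq (term n m)).
Hypothesis HP : pommaret_basis U P.

Let cones : cone_partition (stages P 0) := pommaret_cone_partition HP.

Let forget_syz (A : comAlgType K) (x : fcar (Mf_syz d U P) A) : fcar (Mf d U) A :=
  x.1.
Let forget_res (A : comAlgType K) (x : fcar (Mf_res d U P) A) : fcar (Mf d U) A :=
  x.1.

Lemma mf_mem_extend (A A' : comAlgType K) (sigma : {lrmorphism A -> A'}) M :
  mf_mem (A := A) d U M -> mf_mem d U (extend_scalars sigma M).
Proof.
move=> /(mf_mem_marked_basis d HP)[F basisF]; apply/(mf_mem_marked_basis d HP).
by exists (map_coefs sigma F); apply: (marked_basis_map HP sigma).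
Qed.

Lemma syz_surj (A : comAlgType K) (x : fcar (Mf d U) A) : fmem x ->
  exists2 y, fmem y & forget_syz y = x.
Proof.
move=> xM; have [F basisF] := proj1 (mf_mem_marked_basis d HP x) xM.
by exists (x, syzygies F) => //; split=> //; exists F.
Qed.

Lemma syz_inj (A : comAlgType K) (y y' : fcar (Mf_syz d U P) A) :
  fmem y -> fmem y' -> forget_syz y = forget_syz y' -> y = y'.
Proof.
case: y y' => [M S] [M' S'] [/= _ [F basisF SP]] [/= _ [F' basisF' S'P]].
rewrite /forget_syz /= => eq_M; case: M' / eq_M in basisF' *.
congr pair; apply: predicate_ext => w; apply: iff_trans (SP w) (iff_sym _).
by rewrite (marked_basis_unique HP basisF basisF').
Qed.

Lemma syz_extend (A A' : comAlgType K) (sigma : {lrmorphism A -> A'})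
  (y : fcar (Mf_syz d U P) A) : fmem y -> fmem (fmap sigma y).
Proof.
case: y => M S [/= memM [F basisF SP]]; split; first exact: mf_mem_extend.
exists (map_coefs sigma F); first exact: (marked_basis_map HP sigma).
apply: (extend_scalars_syzygies sigma cones _ _ SP).
  by case: basisF => markedF _ _; apply: (marked_set_rows HP).
exact: (marked_basis_closed HP basisF).
Qed.

Lemma res_surj (A : comAlgType K) (x : fcar (Mf d U) A) : fmem x ->
  exists2 y, fmem y & forget_res y = x.
Proof.
move=> xM; have [F0 basisF] := proj1 (mf_mem_marked_basis d HP x) xM.
have markedF : marked_rows (s := stages P 0) F0.
  by case: basisF => markedF _ _; apply: (marked_set_rows HP).
have closedF := marked_basis_closed HP basisF.
have [F eq_F0 FP] := resolution_exists cones markedF closedF.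
exists ((x, fun t : 'I_(n - pommaret_D P) => syzygies (F t)) : res_car P A) => //.
by split=> //; exists F; split=> //; rewrite eq_F0.
Qed.

Lemma res_inj (A : comAlgType K) (y y' : fcar (Mf_res d U P) A) :
  fmem y -> fmem y' -> forget_res y = forget_res y' -> y = y'.
Proof.
case: y y' => [M S] [M' S'] [/= _ [F [basisF FP SP]]] [/= _ [F' [basisF' F'P S'P]]].
rewrite /forget_res /= => eq_M; case: M' / eq_M in basisF' *.
congr pair; apply: functional_extensionality_dep => t.
apply: predicate_ext => w; apply: iff_trans (SP t w) (iff_sym _).
have -> : F t = F' t; last exact: S'P.
apply: (resolution_unique cones) => //.
- exact: (marked_basis_unique HP basisF basisF').
- by case: basisF => markedF _ _; apply: (marked_set_rows HP).
- exact: (marked_basis_closed HP basisF).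
Qed.

Lemma res_extend (A A' : comAlgType K) (sigma : {lrmorphism A -> A'})
  (y : fcar (Mf_res d U P) A) : fmem y -> fmem (fmap sigma y).
Proof.
case: y => M S [/= memM [F [basisF FP SP]]]; split; first exact: mf_mem_extend.
exists (fun t => map_coefs sigma (F t)); split.
- exact: (marked_basis_map HP sigma).
- by move=> t; apply: (fundamental_syzygies_map sigma (FP t)).
- move=> t.
  have [markedF closedF] : marked_rows (F t) /\ cone_closed (F t).
    apply: (resolution_marked cones) => //;
      last exact: (marked_basis_closed HP basisF).
    by case: basisF => markedF _ _; apply: (marked_set_rows HP).
  exact: (extend_scalars_syzygies sigma (stages_cone_partition cones t)
    markedF closedF (SP t)).
Qed.

Lemma represents_Mf_syz B : represents B (Mf_syz d U P) <-> represents B (Mf d U).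
Proof.
split.
  by apply: (represents_of_lift (p := forget_syz)) => [A y []|||] //;
    [exact: syz_surj | exact: syz_inj].
apply: (represents_lift (p := forget_syz)) => [A y []|||||A] //.
- exact: syz_surj.
- exact: syz_inj.
- exact: syz_extend.
- exact (fun=> True, fun=> True).
Qed.

Lemma represents_Mf_res B : represents B (Mf_res d U P) <-> represents B (Mf d U).
Proof.
split.
  by apply: (represents_of_lift (p := forget_res)) => [A y []|||] //;
    [exact: res_surj | exact: res_inj].
apply: (represents_lift (p := forget_res)) => [A y []|||||A] //.
- exact: res_surj.
- exact: res_inj.
- exact: res_extend.
- exact (fun=> True, fun=> fun=> True).
Qed.

End Functors.

(** * The universal marked family *)

Lemma mpoly_lrmorphism (K : fieldType) (k : nat) (A : comAlgType K)
    (h : 'I_k -> A) :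
  exists psi : {lrmorphism {mpoly K[k]} -> A}, forall i, psi 'X_i = h i.
Proof.
pose f : {rmorphism K -> A} := GRing.in_alg A.
have mmap_scalable : scalable (mmap f h).
  by move=> a p; rewrite mmapZ /f /= mulr_algl.
pose psi : {lrmorphism {mpoly K[k]} -> A} := HB.pack (mmap f h)
  (GRing.isScalable.Build K {mpoly K[k]} A *:%R (mmap f h) mmap_scalable).
by exists psi => i; rewrite /psi /= mmapX mmap1U.
Qed.

Lemma mpoly_lrmorphism_eq (K : fieldType) (k : nat) (A : comAlgType K)
    (f g : {lrmorphism {mpoly K[k]} -> A}) : (forall i, f 'X_i = g 'X_i) -> f =1 g.
Proof.
move=> fg p; rewrite [p]mpolyE !linear_sum; apply: eq_bigr => a _.
rewrite !linearZ; congr (_ *: _); rewrite mpolyXE_id !rmorph_prod.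
by apply: eq_bigr => i _; rewrite !rmorphXn /= fg.
Qed.

Definition row_module (n k m : nat) (A : comNzRingType)
    (F : 'M[{mpoly A[n.+1]}]_(k, m)) (u : 'rV[{mpoly A[n.+1]}]_m) : Prop :=
  exists w : 'rV[{mpoly A[n.+1]}]_k, u = w *m F.

Lemma row_module_generated (n k m : nat) (A : comNzRingType)
  (F : 'M[{mpoly A[n.+1]}]_(k, m)) : generated_by_rows F (row_module F).
Proof. by []. Qed.

Section TailMatrix.

Variables (K : fieldType) (n m : nat) (d : 'I_m -> int).
Variables (U : 'rV[{mpoly K[n.+1]}]_m -> Prop) (P : seq (term n m)).
Hypothesis HP : pommaret_basis U P.

Let s0 := Stage P.
Local Notation head j := (tnth (in_tuple P) j).

(** A term [x^a e_k] of the degree of a head [p] has [|a| = deg p - d k]. *)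
Definition tail_bound : nat :=
  (\max_(j < size P) \max_(k < m) `|term_degree d (head j) - d k|%N).+1.

Definition tail_triple : finType :=
  ('I_(size P) * 'X_{1..n.+1 < tail_bound} * 'I_m)%type.

Definition tail_head (x : tail_triple) : 'I_(size P) := x.1.1.
Definition tail_term (x : tail_triple) : term n m := (bmnm x.1.2, x.2).

Definition is_tail (x : tail_triple) : bool :=
  ~~ divisible (s := s0) (tail_term x) &&
  (term_degree d (tail_term x) == term_degree d (head (tail_head x))).

(** Index set of the free coefficients of a marked set. *)
Definition tail : finType := {x : tail_triple | is_tail x}.

Lemma tail_exists j b : ~~ divisible (s := s0) b ->
  term_degree d b = term_degree d (head j) ->
  exists x : tail, tail_head (val x) = j /\ tail_term (val x) = b.
Proof.
case: b => a k Nb eq_deg.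
have lt_a : (mdeg a < tail_bound)%N.
  rewrite ltnS; apply: leq_trans (leq_bigmax j); apply: leq_trans (leq_bigmax k).
  by rewrite -eq_deg /term_degree addrK.
have tail_x : is_tail (j, BMultinom lt_a, k) by rewrite /is_tail Nb eq_deg eqxx.
by exists (exist is_tail (j, BMultinom lt_a, k) tail_x).
Qed.

Lemma tail_inj (x y : tail) : tail_head (val x) = tail_head (val y) ->
  tail_term (val x) = tail_term (val y) -> x = y.
Proof.
move=> eq_j /pair_equal_spec[eq_a eq_k]; apply/val_inj; move: eq_j eq_a eq_k.
rewrite /tail_head; case: (val x) (val y) => [[j a] k] [[j' a'] k'] /= -> eq_a ->.
by rewrite (val_inj eq_a).
Qed.

Section Ring.

Variable A : comNzRingType.
Implicit Types (c : tail -> A).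

Definition tail_matrix c : 'M[{mpoly A[n.+1]}]_(size P, m) :=
  \matrix_j (tvec A (head j) +
    \sum_(x : tail | tail_head (val x) == j)
      (c x)%:MP *: tvec A (tail_term (val x))).

Lemma coef_tail_matrix c j b : coef (row j (tail_matrix c)) b =
  (head j == b)%:R +
  \sum_(x : tail | tail_head (val x) == j) c x * (tail_term (val x) == b)%:R.
Proof.
rewrite rowK coef_rowD coef_tvec coef_row_sum; congr (_ + _).
by apply: eq_bigr => x _; rewrite coef_rowZ coef_tvec.
Qed.

Lemma tail_neq_head (x : tail) j : (tail_term (val x) == head j) = false.
Proof.
apply/negbTE; case/andP: (valP x) => Nx _; apply: contraNneq Nx => ->.
by apply/existsP; exists j; rewrite eqxx lepm_refl.
Qed.

Lemma coef_tail c (x : tail) :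
  coef (row (tail_head (val x)) (tail_matrix c)) (tail_term (val x)) = c x.
Proof.
rewrite coef_tail_matrix eq_sym tail_neq_head add0r (bigD1 x) //= eqxx mulr1.
rewrite big1 ?addr0 // => y /andP[/eqP eq_j ne_yx].
case: eqP => [/(tail_inj eq_j) eq_yx|]; last by rewrite mulr0.
by rewrite eq_yx eqxx in ne_yx.
Qed.

Lemma coef_tail_matrix_neq0 c j b : coef (row j (tail_matrix c)) b != 0 ->
  head j = b \/
  exists x : tail, tail_head (val x) = j /\ tail_term (val x) = b.
Proof.
rewrite coef_tail_matrix; case: (head j =P b) => [|_]; first by left.
rewrite add0r => sum_neq0; right.
have [/existsP[x /andP[/eqP xj /eqP xb]]|no_x] :=
  boolP [exists x : tail, (tail_head (val x) == j) && (tail_term (val x) == b)].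
  by exists x.
case/eqP: sum_neq0; apply: big1 => x xj.
have -> : (tail_term (val x) == b) = false; last by rewrite mulr0.
by apply: contraNF no_x => xb; apply/existsP; exists x; rewrite xj.
Qed.

Lemma tail_matrix_marked c : marked_set d U (tail_matrix c).
Proof.
apply: (marked_set_intro HP) => [j b|j b /coef_tail_matrix_neq0[<- //|]].
  rewrite coef_rowB coef_tvec /head_term /= => Fb.
  have [eq_jb|ne_jb] := eqVneq (head j) b.
    move: Fb; rewrite coef_tail_matrix -eq_jb eqxx addrC addKr.
    by rewrite big1 ?eqxx // => x _; rewrite tail_neq_head mulr0.
  rewrite (negbTE ne_jb) subr0 in Fb.
  have [eq_jb|[x [_ <-]]] := coef_tail_matrix_neq0 Fb.
    by rewrite eq_jb eqxx in ne_jb.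
  by case/andP: (valP x).
by case=> x [<- <-]; case/andP: (valP x) => _ /eqP.
Qed.

(** A term of a row that is neither its head nor indexed by [tail] would be normal of
    the degree of the head, hence indexed after all. *)
Lemma marked_set_tail_matrix F : marked_set d U F ->
  F = tail_matrix (fun x => coef (row (tail_head (val x)) F) (tail_term (val x))).
Proof.
move=> markedF; set c := fun x => _; have rowsF := marked_set_rows HP markedF.
apply/row_matrixP => j; apply: row_coefP => b.
have [[x [<- <-]]|no_x] := classic
  (exists x : tail, tail_head (val x) = j /\ tail_term (val x) = b).
  by rewrite coef_tail.
have [eq_jb|ne_jb] := eqVneq (head j) b.
  rewrite -eq_jb !(marked_row_head j _) //.
  by apply: (marked_set_rows HP); apply: tail_matrix_marked.
have -> : coef (row j (tail_matrix c)) b = 0.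
  apply/eqP; apply: contraT => /coef_tail_matrix_neq0[eq_jb|] //.
  by rewrite eq_jb eqxx in ne_jb.
apply/eqP; apply: contraT => Fb; case: no_x; apply: tail_exists.
  by apply: (rowsF j); rewrite coef_rowB coef_tvec (negbTE ne_jb) subr0.
exact: (marked_set_homogeneous markedF Fb).
Qed.

End Ring.

Lemma map_tail_matrix (A A' : comNzRingType) (sigma : {rmorphism A -> A'})
    (c : tail -> A) :
  map_coefs sigma (tail_matrix c) = tail_matrix (fun x => sigma (c x)).
Proof.
apply/row_matrixP => j; apply: row_coefP => b.
rewrite row_map_coefs coef_map_coefs !coef_tail_matrix.
rewrite rmorphD rmorph_nat rmorph_sum.
by congr (_ + _); apply: eq_bigr => x _; rewrite rmorphM rmorph_nat.
Qed.

(** The terms of a combination of the heads are multiples of heads, so a normal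
    combination is zero. *)
Lemma tail_matrix0_closed (A : comNzRingType) :
  cone_closed (s := s0) (tail_matrix (fun=> 0 : A)).
Proof.
apply: (normal_cone_closed (pommaret_cone_partition HP)).
  by apply: (marked_set_rows HP); apply: tail_matrix_marked.
move=> v Nv; apply: row_coefP => b; rewrite coef_row0; apply/eqP.
apply: contraT => vb; have := Nv b vb; rewrite -[~~ _]negbK => /negP[].
apply: contraNN vb => Nb; rewrite mulmx_sum_row coef_row_sum big1 // => j _.
apply/eqP; apply: contraNT Nb => /coef_scale_neq0[a [b' [_ Fb' ->]]].
have -> : b' = head j.
  have [//|[x [xj xb']]] := coef_tail_matrix_neq0 Fb'.
  move: Fb'; rewrite coef_tail_matrix big1 ?addr0 => [|y _]; last by rewrite mul0r.
  by case: (head j =P b') => [->|_] //; rewrite eqxx.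
exact: (divisible_head (s := s0)).
Qed.

(** * The representing algebra *)

Local Notation C := {mpoly K[#|tail|]}.

Definition universal_matrix : 'M[{mpoly C[n.+1]}]_(size P, m) :=
  tail_matrix (fun x => 'X_(enum_rank x) : C).

(** These are the coefficients of the remainders on division by the universal marked
    set of the elements of the module that it generates. *)
Definition obstruction (c : C) : Prop :=
  exists (v w : 'rV[{mpoly C[n.+1]}]_(size P)) (h : 'rV[{mpoly C[n.+1]}]_m) b,
    [/\ cone_coefficients (s := s0) w, normal (s := s0) h,
        v *m universal_matrix = w *m universal_matrix + h & c = coef h b].

(** The ideal generated by the obstructions. Taking the intersection of the ideals
    containing them makes the kernel of a morphism a possible choice for [J]. *)
Definition obstruction_ideal (c : C) : Prop :=
  forall J : C -> Prop, ideal J -> (forall r, obstruction r -> J r) -> J c.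

Lemma obstruction_ideal_ideal : ideal obstruction_ideal.
Proof.
split=> [J [] //|r x y Ix Iy J idealJ obsJ].
by apply: (proj2 idealJ); [apply: Ix | apply: Iy].
Qed.

(** If [psi] kills the obstructions, the images of the divisions over [C] have no
    remainder. Conversely the image of a remainder is a normal element of the module
    generated by a marked basis, hence zero. *)
Lemma obstruction_ideal_kernel (A : comAlgType K) (psi : {lrmorphism C -> A}) :
  (forall c, obstruction_ideal c -> psi c = 0) <->
  cone_closed (s := s0) (map_coefs psi universal_matrix).
Proof.
have markedF :=
  marked_set_rows HP (tail_matrix_marked (fun x => 'X_(enum_rank x) : C)).
split=> [kills|closedF c].
  apply: cone_closed_tvec => a j.
  have [w [h [Cw Nh eq_wh]]] := marked_span (pommaret_cone_partition HP)
    (tvec C ((a, j) : term n (size P)) *m universal_matrix) markedF.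
  exists (map_coefs psi w); first exact: cone_coefficients_map.
  rewrite row_map_coefs -map_coefsZX -(tvec_mul (s := s0)) eq_wh.
  rewrite raddfD /= map_coefsM -[RHS]addr0; congr (_ + _); apply: row_coefP => b.
  rewrite coef_map_coefs coef_row0; apply: kills => J _; apply.
  by exists (tvec C ((a, j) : term n (size P))), w, h, b.
move=> /(_ (fun c => psi c = 0)); apply.
  split=> [|r x y x0 y0]; first exact: rmorph0.
  by rewrite rmorphD rmorphM /= x0 y0 mulr0 addr0.
move=> _ [v [w [h [b [Cw Nh eq_vw ->]]]]].
have map_h : map_coefs psi h =
    (map_coefs psi v - map_coefs psi w) *m map_coefs psi universal_matrix.
  by rewrite mulmxBl -!map_coefsM eq_vw raddfD /= addrC addKr.
rewrite -coef_map_coefs map_h.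
rewrite (cone_closed_normal (pommaret_cone_partition HP)) ?coef_row0 //.
  exact: (marked_rows_map (sigma := psi) markedF).
by rewrite -map_h; apply: (normal_map (s := s0)).
Qed.

(** The heads alone are a marked basis over [K], so all obstructions vanish at the
    point where every coefficient is zero. *)
Lemma obstruction_ideal_proper : ~ obstruction_ideal 1.
Proof.
have [psi psiX] := mpoly_lrmorphism (fun _ : 'I_#|tail| => 0 : K^o).
move=> /(proj2 (obstruction_ideal_kernel psi) _) psi1.
case/eqP: (oner_neq0 (K^o : comNzRingType)).
rewrite -(rmorph1 psi); apply: psi1.
rewrite map_tail_matrix; have -> : (fun x => psi 'X_(enum_rank x)) = (fun=> 0).
  by apply: functional_extensionality => x.
exact: tail_matrix0_closed.
Qed.

(** A morphism from the quotient of [C] by the obstruction ideal is a choice of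
    coefficients for which the marked set is a marked basis. *)
Lemma Mf_representable :
  exists2 B : comAlgType K, finite_type B & represents B (Mf d U).
Proof.
have [B [pi [pi_surj ker_pi]]] :=
  quotient_algebra obstruction_ideal_ideal obstruction_ideal_proper.
exists B; first by exists #|tail|, pi.
split.
  by have := @noetherian_image _ _ pi pi_surj; apply; apply: mpoly_noetherian.
pose c (A : comAlgType K) (phi : {lrmorphism B -> A}) (x : tail) :=
  phi (pi 'X_(enum_rank x)).
have basis (A : comAlgType K) (phi : {lrmorphism B -> A}) :
    marked_basis d U (tail_matrix (c A phi)) (row_module (tail_matrix (c A phi))).
  apply: (marked_basis_intro HP) => //; first exact: tail_matrix_marked.
  rewrite -[tail_matrix _](map_tail_matrix (phi \o pi : {lrmorphism C -> A})).
  by apply/obstruction_ideal_kernel => r /ker_pi /= ->; apply: rmorph0.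
exists (fun A phi => row_module (tail_matrix (c A phi))); split.
- move=> A phi _; apply/(mf_mem_marked_basis d HP).
  by exists (tail_matrix (c A phi)).
- move=> A M _ /(mf_mem_marked_basis d HP)[F basisF].
  case: (basisF) => markedF genM _.
  have [psi psiX] := mpoly_lrmorphism (fun i : 'I_#|tail| =>
    coef (row (tail_head (val (enum_val i))) F) (tail_term (val (enum_val i)))).
  have eqF : map_coefs psi universal_matrix = F.
    rewrite map_tail_matrix [RHS](marked_set_tail_matrix markedF).
    congr tail_matrix.
    by apply: functional_extensionality => x; rewrite /= psiX enum_rankK.
  have kills : forall r, obstruction_ideal r -> psi r = 0.
    apply/obstruction_ideal_kernel; rewrite eqF.
    exact: (marked_basis_closed HP basisF).
  have [r /ker_pi /kills //|phi phiE] := lrmorphism_factor pi_surj (psi := psi).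
  exists phi; have -> : tail_matrix (c A phi) = F.
    rewrite -eqF map_tail_matrix; congr tail_matrix.
    by apply: functional_extensionality => x; rewrite /c /= phiE.
  by apply: predicate_ext => u; apply: iff_sym; apply: genM.
- move=> A phi psi _ eq_M b; have [p <-] := pi_surj b.
  have := basis A psi; rewrite -eq_M.
  move=> /(marked_basis_unique HP (basis A phi)) eq_c.
  apply: (mpoly_lrmorphism_eq (f := phi \o pi) (g := psi \o pi)) => i.
  rewrite -[i]enum_valK; change (c A phi (enum_val i) = c A psi (enum_val i)).
  by rewrite -(coef_tail (c A phi)) eq_c coef_tail.
- move=> A A' sigma phi _ _; apply: predicate_ext => u; apply: iff_sym.
  have := extend_scalars_generated sigma
    (row_module_generated (tail_matrix (c A phi))) u.
  by rewrite map_tail_matrix.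
Qed.

End TailMatrix.

(** * Representability of the three functors *)

Theorem corollary4p7 (K : fieldType) (n m : nat) (d : 'I_m -> int)
    (U : 'rV[{mpoly K[n.+1]}]_m -> Prop) (P : seq (term n m))
    (HP : pommaret_basis U P) :
  [/\ exists2 B : comAlgType K, finite_type B & represents B (Mf d U),
      exists B : comAlgType K, represents B (Mf_syz d U P),
      exists B : comAlgType K, represents B (Mf_res d U P)
    & forall B Bsyz Bres : comAlgType K,
        represents B (Mf d U) -> represents Bsyz (Mf_syz d U P) ->
        represents Bres (Mf_res d U P) ->
        isomorphic_algebras Bsyz B /\ isomorphic_algebras Bres B].
Proof.
have [B finB reprB] := Mf_representable d HP; split.
- by exists B.
- by exists B; apply/(represents_Mf_syz d HP).
- by exists B; apply/(represents_Mf_res d HP).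
- move=> B0 Bsyz Bres reprB0 /(represents_Mf_syz d HP) repr_syz.
  move=> /(represents_Mf_res d HP) repr_res.
  by split; apply: represents_unique reprB0.
Qed.
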